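(* The sub-Lorentzian Heisenberg group $\mathbb{H}$ is: (i) strongly causal: the topology having $\{I^+(q_0)\cap I^-(q): q_0,q\in\mathbb{H}\}$ as a subbase (the Alexandrov topology) coincides with the metric topology of $\mathrm{d}$; (ii) causally closed: $\mathbb{H}^2_{\le}$ is a closed subset of $\mathbb{H}\times\mathbb{H}$; (iii) compatible with the sub-Riemannian distance: for every $q\in\mathbb{H}$ there exist a neighbourhood $\mathcal{U}$ of $q$ and a constant $C>0$ such that $\mathrm{L}_{\mathrm{d}}(\gamma)\le C$ for all (future- or past-directed) causal curves $\gamma$ with values in $\mathcal{U}$; (iv) non-totally imprisoning: for every compact $K\subseteq\mathbb{H}$ there is a constant $C>0$ such that $\mathrm{L}_{\mathrm{d}}(\gamma)\le C$ for all (future- or past-directed) causal curves $\gamma$ with values in $K$; (v) globally hyperbolic: it is non-totally imprisoning and $J^+(q_0)\cap J^-(q_1)$ is compact for all $q_0,q_1\in\mathbb{H}$; (vi) $\mathcal{K}$-globally hyperbolic: it is non-totally imprisoning and $J^+(K_1)\cap J^-(K_2)$ is compact for all compact subsets $K_1,K_2\subseteq\mathbb{H}$.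
   Context: $\mathbb{H}=\mathbb{R}^3$ with group law $(x,y,z)\cdot(x',y',z')=(x+x',y+y',z+z'+\tfrac12(xy'-x'y))$ and left-invariant vector fields $X=\partial_x-\tfrac y2\partial_z$, $Y=\partial_y+\tfrac x2\partial_z$. A horizontal curve is an absolutely continuous curve $\gamma:[0,T]\to\mathbb{H}$ with $\dot\gamma=u_1X(\gamma)+u_2Y(\gamma)$ a.e. for some $u=(u_1,u_2)\in L^\infty([0,T],\mathbb{R}^2)$. It is future-directed causal if $u_1\ge|u_2|$ and $u_1>0$ a.e., future-directed timelike if $u_1>|u_2|$ a.e.; past-directed causal/timelike if the same holds with $u_1$ replaced by $-u_1$. Write $q_0\le q$ (resp. $q_0\ll q$) if there is a future-directed causal (resp. timelike) curve from $q_0$ to $q$, with the convention $q_0\le q_0$. $\mathbb{H}^2_{\le}=\{(q_0,q):q_0\le q\}$. For $A\subseteq\mathbb{H}$: $J^+(A)=\{q:\exists q_0\in A,\ q_0\le q\}$, $J^-(A)=\{q:\exists q_0\in A,\ q\le q_0\}$, and $I^\pm(A)$ are defined likewise with $\ll$; $J^\pm(q_0)=J^\pm(\{q_0\})$, $I^\pm(q_0)=I^\pm(\{q_0\})$. The sub-Riemannian distance is $\mathrm{d}(q_0,q)=\inf\int_0^T\sqrt{u_1^2+u_2^2}\,dt$, the infimum over horizontal curves $\gamma:[0,T]\to\mathbb{H}$ from $q_0$ to $q$ with control $u$. It induces the manifold topology. $\mathrm{L}_{\mathrm{d}}(\gamma)$ is the length of $\gamma$ with respect to $\mathrm{d}$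 (the supremum of $\sum_i\mathrm{d}(\gamma(t_i),\gamma(t_{i+1}))$ over finite partitions), which for horizontal curves equals $\int_0^T\sqrt{u_1^2+u_2^2}\,dt$. *)

(* Defs.v *)
From HB Require Import structures.
From mathcomp Require Import all_boot all_order all_algebra.
From mathcomp Require Import all_classical all_reals all_analysis.
From mathcomp Require Import ring.

Set Implicit Arguments.
Unset Strict Implicit.
Unset Printing Implicit Defensive.

Import Order.TTheory GRing.Theory Num.Theory.
Import numFieldNormedType.Exports.

Local Open Scope classical_set_scope.
Local Open Scope ring_scope.

(* A point (x, y, z) of the Heisenberg group is ((x, y), z), so x = q.1.1,
   y = q.1.2, z = q.2; closed sets, compact sets and neighbourhoods of points
   refer to the product (manifold) topology of R^3.  Tangent spaces are
   identified with R^3. *)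
Notation heis R := (R * R * R)%type.

Section heisenberg.
Context {R : realType}.
Implicit Types (p q : heis R) (T : R) (g : R -> heis R) (u : R -> R * R).

Definition heis_mul p q : heis R :=
  (p.1.1 + q.1.1, p.1.2 + q.1.2,
   p.2 + q.2 + 2^-1 * (p.1.1 * q.1.2 - q.1.1 * p.1.2)).

Definition heisX q : heis R := (1, 0, - (q.1.2 / 2)).
Definition heisY q : heis R := (0, 1, q.1.1 / 2).

(* heis_mul p is affine, so these say that the differential of the left
   translation by p at q maps X(q) to X(p q), and Y(q) to Y(p q). *)
Lemma heisX_left_invariant p q (t : R) :
  heis_mul p (q + t *: heisX q) = heis_mul p q + t *: heisX (heis_mul p q).
Proof.
case: p q => [[a b] c] [[x y] z].
by rewrite /heis_mul /heisX; congr (_, _, _); rewrite /= /GRing.scale /=; field.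
Qed.

Lemma heisY_left_invariant p q (t : R) :
  heis_mul p (q + t *: heisY q) = heis_mul p q + t *: heisY (heis_mul p q).
Proof.
case: p q => [[a b] c] [[x y] z].
by rewrite /heis_mul /heisY; congr (_, _, _); rewrite /= /GRing.scale /=; field.
Qed.

Definition absolutely_continuous (V : normedModType R) (a b : R) (f : R -> V) :=
  forall e : R, 0 < e -> exists2 d : R, 0 < d &
    forall (n : nat) (l r : 'I_n -> R),
      (forall i, a <= l i /\ l i <= r i /\ r i <= b) ->
      trivIset [set: 'I_n] (fun i => `]l i, r i[%classic) ->
      \sum_(i < n) (r i - l i) < d ->
      \sum_(i < n) `|f (r i) - f (l i)| < e.

(* A curve on [0, T] is represented by a function on R of which only the
   restriction to [0, T] matters: the derivative is taken at interior points.
   A degenerate interval is excluded, since on it every condition that is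
   required almost everywhere would be void. *)
Definition horizontal T g u :=
  [/\ 0 < T,
      absolutely_continuous 0 T g,
      (fst \o u) \_ `[0, T] \in Lfun lebesgue_measure +oo%E,
      (snd \o u) \_ `[0, T] \in Lfun lebesgue_measure +oo%E &
      {ae lebesgue_measure, forall t : R, t \in `]0, T[ ->
        is_derive t 1 g ((u t).1 *: heisX (g t) + (u t).2 *: heisY (g t))}].

Definition curve_with_controls_in (C : set (R * R)) T g :=
  exists2 u, horizontal T g u &
    {ae lebesgue_measure, forall t : R, t \in `[0, T] -> C (u t)}.

Definition future_causal :=
  curve_with_controls_in [set v | `|v.2| <= v.1 /\ 0 < v.1].
Definition future_timelike :=
  curve_with_controls_in [set v | `|v.2| < v.1].
Definition past_causal :=
  curve_with_controls_in [set v | `|v.2| <= - v.1 /\ 0 < - v.1].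

Definition causal T g := future_causal T g \/ past_causal T g.

Definition causal_le p q :=
  p = q \/ exists T g, [/\ future_causal T g, g 0 = p & g T = q].
Definition chron_lt p q :=
  exists T g, [/\ future_timelike T g, g 0 = p & g T = q].

Definition Jplus (A : set (heis R)) := [set q | exists2 p, A p & causal_le p q].
Definition Jminus (A : set (heis R)) := [set q | exists2 p, A p & causal_le q p].
Definition Iplus (A : set (heis R)) := [set q | exists2 p, A p & chron_lt p q].
Definition Iminus (A : set (heis R)) := [set q | exists2 p, A p & chron_lt q p].

Definition control_length T u : \bar R :=
  (\int[lebesgue_measure]_(t in `[0%R, T])
     (Num.sqrt ((u t).1 ^+ 2 + (u t).2 ^+ 2))%:E)%E.

Definition sr_dist p q : \bar R :=
  ereal_inf [set l | exists T g u,
    [/\ horizontal T g u, g 0 = p, g T = q & l = control_length T u]].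

(* [itv_partition 0 T s] says that 0 < s_0 < ... < s_(n-1) = T, and
   [nth T (0 :: s) i], [nth T s i] are consecutive points of 0 :: s. *)
Definition sr_length T g : \bar R :=
  ereal_sup [set (\sum_(i < size s)
                    sr_dist (g (nth T (0%R :: s) i)) (g (nth T s i)))%E
            | s in itv_partition 0 T].

Definition sr_open (A : set (heis R)) :=
  forall p, A p -> exists2 r : R, 0 < r &
    [set q | (sr_dist p q < r%:E)%E] `<=` A.

End heisenberg.

Definition alexandrov (R : realType) : Type := heis R.
HB.instance Definition _ (R : realType) := Choice.copy (alexandrov R) (heis R).
HB.instance Definition _ (R : realType) :=
  @isSubBaseTopological.Build (alexandrov R)
    (heis R * heis R)%type setT (fun pq => Iplus [set pq.1] `&` Iminus [set pq.2]).

Definition strongly_causal (R : realType) :=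
  forall A : set (heis R), open (A : set (alexandrov R)) <-> sr_open A.

Definition causally_closed (R : realType) :=
  closed [set pq : heis R * heis R | causal_le pq.1 pq.2].

Definition curves_bounded_in (R : realType) (A : set (heis R)) :=
  exists2 C : R, 0 < C & forall (T : R) (g : R -> heis R),
    causal T g -> (forall t, t \in `[0, T] -> A (g t)) ->
    (sr_length T g <= C%:E)%E.

Definition sr_compatible (R : realType) :=
  forall q : heis R, exists2 U, nbhs q U & curves_bounded_in U.

Definition non_totally_imprisoning (R : realType) :=
  forall K : set (heis R), compact K -> curves_bounded_in K.

Definition globally_hyperbolic (R : realType) :=
  non_totally_imprisoning R /\
  forall p q : heis R, compact (Jplus [set p] `&` Jminus [set q]).

Definition K_globally_hyperbolic (R : realType) :=
  non_totally_imprisoning R /\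
  forall K1 K2 : set (heis R), compact K1 -> compact K2 ->
    compact (Jplus K1 `&` Jminus K2).

(* Main.v *)
Require Import Defs.
From mathcomp Require Import all_boot all_order all_algebra.
From mathcomp Require Import all_classical all_reals all_analysis.
From mathcomp Require Import measurable_realfun ess_sup_inf ring lra.

(* In the null coordinates a = x + y, b = x - y of the point q relative to p, a
   future-directed causal curve from p is one along which a and b are
   nondecreasing; as z' = (b a' - a b') / 4, the functions a b - 4 z and
   a b + 4 z are then nondecreasing too.  Hence p <= q forces |y| <= x and
   4 |z| <= x^2 - y^2 for (x, y, z) = p^-1 q.  Conversely every such q is reached
   from p by two straight causal segments, so that the causal relation is given
   by these closed polynomial inequalities, the chronological one by their
   strict (open) versions.  The two segments together have length at most 2 x,
   so the d-length of any causal curve telescopes to at most twice the variation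
   of its x-coordinate, and causal diamonds are bounded and d-small. *)

Set Implicit Arguments.
Unset Strict Implicit.
Unset Printing Implicit Defensive.

Import Order.TTheory GRing.Theory Num.Theory.
Import numFieldNormedType.Exports.

Local Open Scope classical_set_scope.
Local Open Scope ring_scope.

(** The conditions on a curve hold only almost everywhere, so every pointwise inequality has to be
    drawn from the sign of an a.e. derivative. For functions that are merely continuous this
    inference fails; absolute continuity is what makes it valid, and all curve estimates reduce to
    that one scalar fact. The two quadratic functions arise from (a b)' = a' b + a b': subtracting
    or adding 4 z' = b a' - a b' leaves 2 a b' or 2 a' b. These products are nonnegative only once a
    and b are, so the null coordinates must be treated before the quadratic functions. The distance
    is estimated from above by explicit paths made of straight segments, and from below by a
    displacement bound: a curve of length less than r moves x and y by at most r and z, relative to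
    its start, by at most r^2. *)

#[local] Instance ae_lebesgue_filter (R : realType) :
  Filter (almost_everywhere (@lebesgue_measure R)).
Proof. exact: (ae_filter_ringOfSetsType (@lebesgue_measure R)). Qed.

(** * Absolutely continuous functions *)

Section monotonicity.
Context {R : realType}.
Notation mu := (@lebesgue_measure R).

(** Cousin's theorem on tagged partitions in the form of an induction principle. Let c be the
    supremum of the points that [P] reaches from a: the cell tagged at c joins a point reached
    before c to one beyond it, unless b has been reached. *)
Lemma cousin_induction (P : R -> R -> Prop) (a b : R) : a <= b ->
  (forall l m r, a <= l -> l <= m -> m <= r -> r <= b ->
    P l m -> P m r -> P l r) ->
  (forall t, a <= t <= b -> exists2 d, 0 < d & forall l r,
    a <= l -> t - d < l -> l <= t -> t <= r -> r < t + d -> r <= b -> P l r) ->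
  P a b.
Proof.
move=> ab Padd Ploc.
pose S := [set s | a <= s <= b /\ P a s].
have Sa : S a.
  split; first by rewrite lexx.
  have [|d d0 H] := Ploc a; first by rewrite lexx.
  by apply: H => //; rewrite ?ltrBlDr ltrDl.
have Sub : ubound S b by move=> x [/andP[]].
have supS : has_sup S by split; [exists a|exists b].
pose c := sup S.
have ac : a <= c by apply: ub_le_sup => //; exists b.
have cb : c <= b by apply: ge_sup => //; exists a.
have [|d d0 H] := Ploc c; first by rewrite ac cb.
have [s Ss cs] := sup_adherent d0 supS.
have [/andP[as_ sb] Ps] := Ss.
have sc : s <= c by apply: ub_le_sup => //; exists b.
have Pr r : c <= r -> r < c + d -> r <= b -> P a r.
  move=> cr rd rb; apply: (Padd a s r) => //; first exact: le_trans cr.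
  exact: H.
have [bcd|cdb] := ltP b (c + d); first by apply: Pr.
have : S (c + d / 2).
  split; first by apply/andP; split; lra.
  by apply: Pr; lra.
move=> /(ub_le_sup (ex_intro _ b Sub)); rewrite -/c; lra.
Qed.

Lemma is_derive1_near (f : R -> R) (t d e : R) : is_derive t 1 f d -> 0 < e ->
  exists2 eta, 0 < eta & forall s, `|s - t| < eta ->
    `|f s - f t - d * (s - t)| <= e * `|s - t|.
Proof.
move=> [df dE] e0.
have /cvgrPdist_le/(_ _ e0) : (fun h => h^-1 *: ((f \o shift t) (h *: 1) - f t))
    @ 0^' --> d by rewrite -dE.
move=> /nbhs_ballP[eta /= eta0 H]; exists eta => // s st.
have [->|sNt] := eqVneq s t; first by rewrite !subrr mulr0 subr0 normr0 mulr0.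
have st0 : s - t != 0 by rewrite subr_eq0.
have := H (s - t); rewrite /ball/= sub0r normrN => /(_ st st0).
rewrite /GRing.scale/= mulr1 subrK => {}H.
rewrite (_ : _ - _ - _ = - ((d - (s - t)^-1 * (f s - f t)) * (s - t))).
  by rewrite normrN normrM ler_wpM2r.
by field.
Qed.


Lemma ac_sub_itv (V : normedModType R) (f : R -> V) (a b c d : R) :
  a <= c -> d <= b -> absolutely_continuous a b f -> absolutely_continuous c d f.
Proof.
move=> ac db acf e e0; have [eta eta0 H] := acf e e0; exists eta => // n l r lr.
apply: H => i; have [cl [lri rd]] := lr i.
by split; [exact: le_trans cl|split=> //; exact: le_trans db].
Qed.

(** Ordered lists of intervals replace indexed disjoint families, so that the partitions of two
    adjacent intervals can be concatenated. *)
Lemma ac_seq (V : normedModType R) (f : R -> V) (a b : R) :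
  absolutely_continuous a b f -> forall e, 0 < e -> exists2 d, 0 < d &
  forall s : seq (R * R), (forall p, p \in s -> a <= p.1 /\ p.1 <= p.2 /\ p.2 <= b) ->
    pairwise (fun p q => p.2 <= q.1) s ->
    \sum_(p <- s) (p.2 - p.1) < d -> \sum_(p <- s) `|f p.2 - f p.1| < e.
Proof.
move=> acf e e0; have [d d0 H] := acf e e0; exists d => // s sab ps sd.
pose x0 : R * R := (0, 0).
have := H (size s) (fun i => (nth x0 s i).1) (fun i => (nth x0 s i).2).
rewrite -(big_mkord xpredT (fun i => (nth x0 s i).2 - (nth x0 s i).1)).
rewrite -(big_mkord xpredT (fun i => `|f (nth x0 s i).2 - f (nth x0 s i).1|)).
rewrite -(big_nth x0 xpredT (fun p => p.2 - p.1)).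
rewrite -(big_nth x0 xpredT (fun p => `|f p.2 - f p.1|)).
apply => //; first by move=> i; apply: sab; exact: mem_nth.
have dis (i j : 'I_(size s)) : (i < j)%N -> (nth x0 s i).2 <= (nth x0 s j).1.
  by move=> ij; move/(pairwiseP x0) : ps; apply => //; rewrite inE.
apply/trivIsetP => i j _ _ ij; rewrite -subset0 => t /=.
rewrite !in_itv/= => -[/andP[it ti] /andP[jt tj]].
have [/dis|/dis|/val_inj/eqP] := ltngtP i j; last by rewrite (negbTE ij).
- by move/(lt_le_trans ti)/lt_trans/(_ jt); rewrite ltxx.
- by move/(lt_le_trans tj)/lt_trans/(_ it); rewrite ltxx.
Qed.

(* Cover the exceptional null set by an open U of small measure.  In a Cousin
   partition the cells tagged outside U are controlled by the derivative, and
   absolute continuity makes the total contribution of the others small. *)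
Lemma ac_nondecreasing (f : R -> R) (a b : R) : a <= b ->
  absolutely_continuous a b f ->
  {ae mu, forall t, t \in `]a, b[ -> exists2 d, 0 <= d & is_derive t 1 f d} ->
  f a <= f b.
Proof.
move=> ab acf [N [mN N0 HN]].
apply/ler_addgt0Pr => e e0.
(* The error is eta per unit length on the well-behaved cells plus one eta for all the others: eta
   (b - a) + eta = e. *)
pose eta := e / (b - a + 1).
have ba1 : 0 < b - a + 1 by lra.
have eta0 : 0 < eta by rewrite divr_gt0.
have [d d0 Hd] := ac_seq acf eta0.
(* The end points join the null set because the derivative is given only on the open interval; every
   tag outside U is then a point of differentiability. *)
pose N1 := N `|` [set a; b].
have mN1 : measurable N1 by apply: measurableU => //; apply: measurableU.
have N10 : (mu N1 = 0)%E.
  apply: (measure_negligible mN1); apply: negligibleU; first by (exists N; split).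
  apply: negligibleU; apply/negligibleP;
    [exact: measurable_set1|exact: lebesgue_measure_set1|
     exact: measurable_set1|exact: lebesgue_measure_set1].
have [U [oU N1U Ud]] : exists U : set R, [/\ open U, N1 `<=` U & (mu U < d%:E)%E].
  have N1fin : (mu N1 < +oo)%E by rewrite N10 ltry.
  have [U [oU N1U Ud]] := lebesgue_regularity_outer mN1 N1fin d0.
  exists U; split => //; apply: le_lt_trans Ud.
  have mU : measurable U by exact: open_measurable.
  have -> : (mu U = mu (U `\` N1))%E.
    transitivity (mu (U `\` N1) + mu (U `&` N1))%E; first exact: measureDI.
    by rewrite (setIidr N1U) N10 adde0.
  exact: lexx.
have mU : measurable U by exact: open_measurable.
(* The list s holds the cells tagged in U. Half-open intervals make the measures of adjacent pieces
   add up exactly. *)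
pose P l r := exists s : seq (R * R),
  [/\ (forall p, p \in s -> l <= p.1 /\ p.1 <= p.2 /\ p.2 <= r),
      pairwise (fun p q => p.2 <= q.1) s,
      ((\sum_(p <- s) (p.2 - p.1))%:E <= mu (U `&` `[l, r[))%E &
      f l - f r <= eta * (r - l) + \sum_(p <- s) `|f p.2 - f p.1|].
suff [s [sab ps sU fs]] : P a b.
  have /(Hd _ sab ps) : \sum_(p <- s) (p.2 - p.1) < d.
    rewrite -lte_fin; apply: le_lt_trans Ud; apply: le_trans sU _.
    apply: le_measure; rewrite ?inE//.
    by apply: measurableI => //; exact: measurable_itv.
  move=> /ltW se.
  have -> : e = eta * (b - a) + eta by rewrite /eta; field; lra.
  by rewrite -lerBlDl; apply: (le_trans fs); rewrite lerD2l.
apply: cousin_induction => //.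
- move=> l m r al lm mr rb [s [sab ps sU fs]] [s' [sab' ps' sU' fs']].
  exists (s ++ s'); split.
  + move=> p; rewrite mem_cat => /orP[/sab[lp [pp pm]]|/sab'[lp [pp pm]]].
      by split=> //; split=> //; exact: le_trans mr.
    by split=> //; exact: le_trans lp.
  + rewrite pairwise_cat ps ps' !andbT; apply/allrelP => p q ps1 qs1.
    have [_ [_ pm]] := sab _ ps1; have [mq _] := sab' _ qs1.
    exact: le_trans mq.
  + rewrite big_cat EFinD/=.
    have -> : U `&` `[l, r[ = (U `&` `[l, m[) `|` (U `&` `[m, r[).
      rewrite -setIUr; congr (_ `&` _).
      by rewrite -itv_bndbnd_setU// bnd_simp.
    rewrite measureU; first exact: leeD.
    * by apply: measurableI => //; exact: measurable_itv.
    * by apply: measurableI => //; exact: measurable_itv.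
    * rewrite -subset0 => t /= [[_ +] [_]]; rewrite !in_itv/=.
      by move=> /andP[_ tm] /andP[mt _]; move: (lt_le_trans tm mt); rewrite ltxx.
  + rewrite big_cat/=; move: fs fs'; lra.
- move=> t /andP[at_ tb]; have [tU|tU] := pselect (U t).
    have /nbhs_ballP[d' /= d'0 H] := open_nbhs_nbhs (conj oU tU).
    exists d' => // l r al tl lt tr rt rb.
    have lr : l <= r by exact: le_trans tr.
    exists [:: (l, r)]; split.
    + by move=> p; rewrite inE => /eqP ->/=; rewrite !lexx.
    + by [].
    + rewrite big_seq1/= (_ : U `&` _ = `[l, r[%classic).
        by rewrite lebesgue_measure_itv/= lte_fin; case: ltP => // rl; rewrite lee_fin; lra.
      apply/setIidPr => u /=; rewrite in_itv/= => /andP[lu ur]; apply: H.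
      by rewrite /ball/= ltr_distlC; apply/andP; split; lra.
    + rewrite big_seq1/= distrC.
      have := ler_norm (f l - f r); have := mulr_ge0 (ltW eta0) (_ : 0 <= r - l).
      by rewrite subr_ge0 => /(_ lr); lra.
have [dt dt0 fdt] : exists2 d, 0 <= d & is_derive t 1 f d.
  have : ~ N t by move=> Nt; apply: tU; apply: N1U; left.
  move=> /(contra_notP (HN t)); apply.
  have ta : t != a by apply/eqP => ta; apply: tU; apply: N1U; right; left.
  have tb' : t != b by apply/eqP => tb'; apply: tU; apply: N1U; right; right.
  by rewrite in_itv/= !lt_neqAle eq_sym ta at_ tb' tb.
have [d' d'0 H] := is_derive1_near fdt eta0.
exists d' => // l r al tl lt tr rt rb.
(* A tag outside U lists no cell: comparing the first-order expansions at t to the left and to the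
   right, the slope [dt] has the favourable sign and the error is eta (r - l). *)
exists [::]; split => //; first by rewrite big_nil.
rewrite big_nil addr0.
have hl : `|l - t| < d' by rewrite ltr_distlC; apply/andP; split; lra.
have hr : `|r - t| < d' by rewrite ltr_distlC; apply/andP; split; lra.
move: (H _ hl) (H _ hr).
rewrite (ger0_norm (_ : 0 <= r - t)) ?subr_ge0// (ler0_norm (_ : l - t <= 0)) ?subr_le0//.
rewrite !ler_norml => /andP[_ h2] /andP[h1 _].
have h3 : 0 <= dt * (r - t) by rewrite mulr_ge0// subr_ge0.
have h4 : 0 <= dt * (t - l) by rewrite mulr_ge0// subr_ge0.
lra.
Qed.


Lemma ae_itv_ex (Q : R -> Prop) (a b : R) : a < b ->
  {ae mu, forall t, t \in `]a, b[ -> Q t} -> exists2 t, t \in `]a, b[ & Q t.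
Proof.
move=> ab [N [mN N0 HN]]; apply: contrapT => nex.
have sub : `]a, b[%classic `<=` N.
  by move=> t tab; apply: HN => /(_ tab) Qt; apply: nex; exists t.
have : (mu `]a, b[%classic <= mu N)%E.
  by apply: le_measure => //; rewrite inE; [exact: measurable_itv|exact: mN].
have -> : mu N = 0%E by exact: N0.
by rewrite lebesgue_measure_itv/= lte_fin ab lee_fin subr_le0 leNgt ab.
Qed.

(** Equal end values would make the monotone f constant, and a single point with positive derivative
    refutes this; the a.e. hypothesis provides one. *)
Lemma ac_increasing (f : R -> R) (a b : R) : a < b ->
  absolutely_continuous a b f ->
  {ae mu, forall t, t \in `]a, b[ -> exists2 d, 0 < d & is_derive t 1 f d} ->
  f a < f b.
Proof.
move=> ab acf aef.
have mono s t : a <= s -> s <= t -> t <= b -> f s <= f t.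
  move=> as_ st tb; apply: ac_nondecreasing => //; first exact: ac_sub_itv acf.
  apply: filterS aef => u + ust; move=> [|d d0 fd]; last by exists d => //; exact: ltW.
  by apply: subset_itvW ust.
rewrite lt_neqAle (mono _ _ (lexx a) (ltW ab) (lexx b)) andbT.
apply/eqP => fab.
have cst t : a <= t -> t <= b -> f t = f a.
  by move=> at_ tb; apply/eqP; rewrite eq_le [X in _ && X]mono// fab mono.
have [t tab [d d0 fd]] := ae_itv_ex ab aef.
move: tab; rewrite in_itv/= => /andP[at_ tb].
have d20 : 0 < d / 2 by rewrite divr_gt0.
have [e e0 H] := is_derive1_near fd d20.
pose h := Num.min (e / 2) (b - t).
have h0 : 0 < h by rewrite lt_min; apply/andP; split; lra.
have he : h < e by rewrite gt_min; apply/orP; left; lra.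
have hb : h <= b - t by rewrite ge_min lexx orbT.
have := H (t + h); rewrite [t + h]addrC addrK gtr0_norm// => /(_ he).
rewrite !cst; [|lra..]; rewrite subrr sub0r normrN normrM !gtr0_norm//.
by rewrite ler_pM2r//; lra.
Qed.

(** Transfers absolute continuity from the curve to its coordinates through Lipschitz estimates. No
    sign is assumed for K, hence [K'] in the proof. *)
Lemma ac_dominated (V W : normedModType R) (g : R -> V) (f : R -> W) (a b K : R) :
  (forall l r, a <= l -> l <= r -> r <= b -> `|f r - f l| <= K * `|g r - g l|) ->
  absolutely_continuous a b g -> absolutely_continuous a b f.
Proof.
move=> fg acg e e0.
pose K' := `|K| + 1; have K'0 : 0 < K' by rewrite ltr_wpDl.
have [d d0 H] := acg _ (divr_gt0 e0 K'0).
exists d => // n l r lr dis sd.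
have := H n l r lr dis sd; rewrite ltr_pdivlMr// mulrC mulr_sumr.
apply: le_lt_trans; apply: ler_sum => i _.
have [al [lri rb]] := lr i.
apply: (le_trans (fg _ _ al lri rb)); apply: ler_wpM2r => //.
by rewrite (le_trans (ler_norm _))// lerDl.
Qed.

Lemma lipschitz_ac (W : normedModType R) (f : R -> W) (a b K : R) :
  (forall l r, a <= l -> l <= r -> r <= b -> `|f r - f l| <= K * (r - l)) ->
  absolutely_continuous a b f.
Proof.
move=> fK; apply: (@ac_dominated _ _ (id : R -> R^o) _ _ _ K).
  move=> l r al lr rb; rewrite [X in _ * X]ger0_norm ?subr_ge0//; exact: fK.
move=> e e0; exists e => // n l r lr _; apply: le_lt_trans.
by apply: ler_sum => i _; have [_ [? _]] := lr i; rewrite ger0_norm// subr_ge0.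
Qed.

Lemma acD (V : normedModType R) (f g : R -> V) (a b : R) :
  absolutely_continuous a b f -> absolutely_continuous a b g ->
  absolutely_continuous a b (f + g).
Proof.
move=> acf acg e e0.
have e20 : 0 < e / 2 by rewrite divr_gt0.
have [d d0 H] := acf _ e20; have [d' d'0 H'] := acg _ e20.
exists (Num.min d d'); first by rewrite lt_min d0.
move=> n l r lr dis; rewrite lt_min => /andP[/(H _ _ _ lr dis) h /(H' _ _ _ lr dis) h'].
rewrite (splitr e); apply: le_lt_trans (ltrD h h'); rewrite -big_split/=.
apply: ler_sum => i _; rewrite [X in `|X|](_ : _ = (f (r i) - f (l i)) + (g (r i) - g (l i))).
  exact: ler_normD.
by rewrite /= opprD addrACA.
Qed.

Lemma is_derive_fst (V W : normedModType R) (g : R -> V * W) (t : R) (d : V * W) :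
  is_derive t 1 g d -> is_derive t 1 (fst \o g) d.1.
Proof.
move=> [dg gd]; have gl : (fun h => h^-1 *: ((g \o shift t) (h *: 1) - g t)) @ 0^' --> d.
  by rewrite -gd.
have fl := cvg_comp _ _ gl (@cvg_fst _ _ (nbhs d.1) (nbhs d.2) _).
by split; [apply/cvg_ex; exists d.1; exact: fl|apply/cvg_lim => //; exact: fl].
Qed.

Lemma is_derive_snd (V W : normedModType R) (g : R -> V * W) (t : R) (d : V * W) :
  is_derive t 1 g d -> is_derive t 1 (snd \o g) d.2.
Proof.
move=> [dg gd]; have gl : (fun h => h^-1 *: ((g \o shift t) (h *: 1) - g t)) @ 0^' --> d.
  by rewrite -gd.
have fl := cvg_comp _ _ gl (@cvg_snd _ _ (nbhs d.1) (nbhs d.2) _).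
by split; [apply/cvg_ex; exists d.2; exact: fl|apply/cvg_lim => //; exact: fl].
Qed.

End monotonicity.

(** * The cone containing the causal future *)

Section cones.
Context {R : realType}.
Notation mu := (@lebesgue_measure R).
Implicit Types (p q : heis R) (T : R) (g : R -> heis R) (u : R -> R * R).

(* (dx p q, dy p q, dz p q) are the coordinates of p^-1 q. *)
Definition dx p q : R := q.1.1 - p.1.1.
Definition dy p q : R := q.1.2 - p.1.2.
Definition dz p q : R := q.2 - p.2 - (p.1.1 * q.1.2 - q.1.1 * p.1.2) / 2.

Definition cone_le p q :=
  `|dy p q| <= dx p q /\ 4 * `|dz p q| <= dx p q ^+ 2 - dy p q ^+ 2.
Definition cone_lt p q :=
  `|dy p q| < dx p q /\ 4 * `|dz p q| < dx p q ^+ 2 - dy p q ^+ 2.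

(** The equation [k ^+ 2 = 1] encodes a sign, which lets one argument serve both null coordinates
    and both time orientations. *)
Lemma sqr1_mul_le (k x : R) : k ^+ 2 = 1 -> k * x <= `|x|.
Proof.
move=> /eqP; rewrite sqrf_eq1 => /orP[]/eqP->; first by rewrite mul1r ler_norm.
by rewrite mulN1r -normrN ler_norm.
Qed.

Lemma coord_norm_le p :
  [/\ `|p.1.1| <= `|p|, `|p.1.2| <= `|p| & `|p.2| <= `|p|].
Proof.
have n (V W : normedModType R) (v : V * W) : `|v.1| <= `|v| /\ `|v.2| <= `|v|.
  by rewrite prod_normE !le_max !lexx orbT.
have [h1 h2] := n _ _ p; have [h3 h4] := n _ _ p.1.
by split=> //; exact: le_trans h1.
Qed.

Lemma dx_lip p q q' : `|dx p q' - dx p q| <= `|q' - q|.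
Proof.
have [h _ _] := coord_norm_le (q' - q); apply: le_trans h.
by rewrite le_eqVlt; apply/orP; left; apply/eqP; congr `|_|; rewrite /dx /=; ring.
Qed.

Lemma dy_lip p q q' : `|dy p q' - dy p q| <= `|q' - q|.
Proof.
have [_ h _] := coord_norm_le (q' - q); apply: le_trans h.
by rewrite le_eqVlt; apply/orP; left; apply/eqP; congr `|_|; rewrite /dy /=; ring.
Qed.

(** For fixed p, [dz p] is affine, hence globally Lipschitz although the group law is quadratic. *)
Lemma dz_lip p q q' :
  `|dz p q' - dz p q| <= (1 + `|p|) * `|q' - q|.
Proof.
have [h1 h2 h3] := coord_norm_le (q' - q); have [k1 k2 _] := coord_norm_le p.
rewrite (_ : _ - _ = (q' - q).2 - (p.1.1 * (q' - q).1.2 - p.1.2 * (q' - q).1.1) / 2).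
  apply: (le_trans (ler_normB _ _)).
  rewrite [leRHS]mulrDl [X in _ <= X + _]mul1r lerD// normrM.
  rewrite (ger0_norm (_ : 0 <= 2^-1)) ?invr_ge0//.
  have := ler_normB (p.1.1 * (q' - q).1.2) (p.1.2 * (q' - q).1.1).
  rewrite !normrM.
  have := ler_pM (normr_ge0 _) (normr_ge0 _) k1 h2.
  have := ler_pM (normr_ge0 _) (normr_ge0 _) k2 h1.
  lra.
by rewrite /dz /=; field.
Qed.

Section derivatives.
Context (p : heis R) (g : R -> heis R) (t : R) (v : R * R).
Context (dg : is_derive t 1 g (v.1 *: heisX (g t) + v.2 *: heisY (g t))).

Let dg1 := is_derive_fst (is_derive_fst dg).
Let dg2 := is_derive_snd (is_derive_fst dg).
Let dg3 := is_derive_snd dg.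

Lemma is_derive_dx : is_derive t 1 (fun r => dx p (g r)) v.1.
Proof.
apply: is_derive_eq (is_deriveB dg1 (is_derive_cst p.1.1 t 1)) _.
by rewrite /= /GRing.scale/=; ring.
Qed.

Lemma is_derive_dy : is_derive t 1 (fun r => dy p (g r)) v.2.
Proof.
apply: is_derive_eq (is_deriveB dg2 (is_derive_cst p.1.2 t 1)) _.
by rewrite /= /GRing.scale/=; ring.
Qed.

(** Left translation by p^-1 keeps the controls, so this is the third component of the horizontal
    equation for p^-1 g: the rate at which the projected curve sweeps signed area. *)
Lemma is_derive_dz : is_derive t 1 (fun r => dz p (g r))
  ((dx p (g t) * v.2 - dy p (g t) * v.1) / 2).
Proof.
have h1 := is_deriveZ (p.1.2 / 2) dg1.
have h2 := is_deriveZ (p.1.1 / 2) dg2.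
have h3 := is_deriveB dg3 (is_derive_cst p.2 t 1).
have h := is_deriveD (is_deriveB h3 h2) h1.
rewrite (_ : (fun r => _) = ((snd \o g) - cst p.2 - (p.1.1 / 2 \*: (snd \o (fst \o g)))
   + (p.1.2 / 2 \*: (fst \o (fst \o g))))).
  by apply: is_derive_eq h _; rewrite /= /GRing.scale/= /dx/dy; field.
by apply/funext => r; rewrite /dz /= !fctE /= /GRing.scale/=; field.
Qed.

(* For k = 1 and k = -1 the derivative factors as
   2 (dx + k dy) (v.1 - k v.2). *)
Lemma is_derive_cone (k : R) :
  is_derive t 1 (fun r => dx p (g r) ^+ 2 - dy p (g r) ^+ 2 - 4 * k * dz p (g r))
   (2 * (dx p (g t) * (v.1 - k * v.2) - dy p (g t) * (v.2 - k * v.1))).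
Proof.
have h := is_deriveB (is_deriveB (is_deriveX 2 is_derive_dx) (is_deriveX 2 is_derive_dy))
  (is_deriveZ (4 * k) is_derive_dz).
by apply: is_derive_eq h _; rewrite /= /GRing.scale/=; field.
Qed.

End derivatives.

Section cone_necessity.
Context (T : R) (g : R -> heis R) (u : R -> R * R) (s t : R).
Context (hor : horizontal T g u) (s0 : 0 <= s) (st : s < t) (tT : t <= T).
Let p := g s.

Let acg : absolutely_continuous s t g.
Proof. by case: hor => _ ac _ _ _; exact: ac_sub_itv ac. Qed.

Let aeg : {ae mu, forall r, r \in `]s, t[ ->
  is_derive r 1 g ((u r).1 *: heisX (g r) + (u r).2 *: heisY (g r))}.
Proof.
case: hor => _ _ _ _; apply: filterS => r + rst; apply.
by apply: subset_itvW rst.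
Qed.

Let ac_coord (c k : R) (a b : R) : s <= a -> b <= t ->
  absolutely_continuous a b (fun r => c * (dx p (g r) + k * dy p (g r))).
Proof.
move=> sa bt; apply: (@ac_dominated _ _ _ g _ _ _ (`|c| * (1 + `|k|)));
  last exact: ac_sub_itv acg.
move=> l r _ _ _; rewrite -mulrBr normrM -mulrA; apply: ler_wpM2l => //.
rewrite (_ : _ - _ = (dx p (g r) - dx p (g l)) + k * (dy p (g r) - dy p (g l))); last by ring.
apply: (le_trans (ler_normD _ _)); rewrite mulrDl mul1r normrM.
by apply: lerD; [exact: dx_lip|apply: ler_wpM2l => //; exact: dy_lip].
Qed.

(** Squares are Lipschitz only on bounded sets, hence the bound M. It will come from the
    monotonicity of the null coordinates. *)
Let ac_cone (k M : R) :
  (forall r, s <= r -> r <= t -> `|dx p (g r)| <= M /\ `|dy p (g r)| <= M) ->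
  absolutely_continuous s t
    (fun r => dx p (g r) ^+ 2 - dy p (g r) ^+ 2 - 4 * k * dz p (g r)).
Proof.
move=> HM; apply: (@ac_dominated _ _ _ g _ _ _ (4 * M + 4 * `|k| * (1 + `|p|))) => //.
move=> l r sl lr rt.
have [xl yl] := HM l sl (le_trans lr rt); have [xr yr] := HM r (le_trans sl lr) rt.
set D := `|g r - g l|.
have sq (a b : R) : `|a| <= M -> `|b| <= M -> `|b - a| <= D -> `|b ^+ 2 - a ^+ 2| <= 2 * M * D.
  move=> aM bM abD; rewrite (_ : _ - _ = (b + a) * (b - a)); last by ring.
  rewrite normrM; apply: ler_pM => //.
  by apply: (le_trans (ler_normD _ _)); lra.
have hx := sq _ _ xl xr (dx_lip _ _ _).
have hy := sq _ _ yl yr (dy_lip _ _ _).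
have hz : `|4 * k * (dz p (g r) - dz p (g l))| <= 4 * `|k| * (1 + `|p|) * D.
  rewrite !normrM ger0_norm// -[leRHS]mulrA; apply: ler_wpM2l; last exact: dz_lip.
  by rewrite mulr_ge0.
move: hx hy hz; move: (dx p (g r)) (dy p (g r)) (dz p (g r)).
move: (dx p (g l)) (dy p (g l)) (dz p (g l)).
move=> x' y' z' x y z hx hy hz.
rewrite (_ : _ - _ - (_ - _) =
  (x ^+ 2 - x' ^+ 2) - (y ^+ 2 - y' ^+ 2) - 4 * k * (z - z')); last by ring.
apply: (le_trans (ler_normB _ _)); apply: (le_trans (lerD (ler_normB _ _) (lexx _))).
apply: (le_trans (lerD (lerD hx hy) hz)).
by rewrite le_eqVlt; apply/orP; left; apply/eqP; ring.
Qed.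

Let dxx : dx p p = 0. Proof. by rewrite /dx subrr. Qed.
Let dyy : dy p p = 0. Proof. by rewrite /dy subrr. Qed.
Let dzz : dz p p = 0. Proof. by rewrite /dz !subrr mul0r subrr. Qed.

(** The sign c is the time orientation, so future- and past-directed curves share one proof; the
    second inequality is even in [dx] and hence free of c. *)
Lemma cone_of_causal_controls (c : R) : c ^+ 2 = 1 ->
  {ae mu, forall r, r \in `[0, T] -> `|(u r).2| <= c * (u r).1} ->
  `|dy p (g t)| <= c * dx p (g t) /\
  4 * `|dz p (g t)| <= dx p (g t) ^+ 2 - dy p (g t) ^+ 2.
Proof.
move=> c1 aeu.
have aegu : {ae mu, forall r, r \in `]s, t[ ->
   is_derive r 1 g ((u r).1 *: heisX (g r) + (u r).2 *: heisY (g r)) /\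
   `|(u r).2| <= c * (u r).1}.
  apply: filterS2 aeg aeu => r h1 h2 rst; split; [exact: h1|apply: h2].
  by apply: subset_itvW rst.
have null k a b : k ^+ 2 = 1 -> s <= a -> a <= b -> b <= t ->
    c * (dx p (g a) + k * dy p (g a)) <= c * (dx p (g b) + k * dy p (g b)).
  move=> k1 sa ab bt.
  apply: (ac_nondecreasing (f := fun r => c * (dx p (g r) + k * dy p (g r)))) => //.
    exact: ac_coord.
  apply: filterS aegu => r h rab; have [|dr ur] := h; first by apply: subset_itvW rab.
  exists (c * ((u r).1 + k * (u r).2)).
    rewrite mulrDr mulrA -lerBlDr sub0r (le_trans _ ur)//.
    by rewrite -mulNr sqr1_mul_le// sqrrN exprMn c1 k1 mulr1.
  apply: is_derive_eq (is_deriveZ c (is_deriveD (is_derive_dx p dr)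
    (is_deriveZ k (is_derive_dy p dr)))) _.
  by [].
have null0 k r : k ^+ 2 = 1 -> s <= r -> r <= t -> 0 <= c * (dx p (g r) + k * dy p (g r)).
  move=> k1 sr rt; rewrite (le_trans _ (null k s r k1 _ _ _))//.
  by rewrite -/p dxx dyy mulr0 addr0 mulr0.
have N1 : (-1 : R) ^+ 2 = 1 by ring.
have dydx r : s <= r -> r <= t -> `|dy p (g r)| <= c * dx p (g r).
  move=> sr rt; have := null0 1 r (expr1n _ _) sr rt; have := null0 (-1) r N1 sr rt.
  move/eqP: c1; rewrite sqrf_eq1 ler_norml => /orP[]/eqP -> h1 h2; lra.
split; first by apply: dydx => //; exact: ltW.
have f0 k : k ^+ 2 = 1 -> 0 <= dx p (g t) ^+ 2 - dy p (g t) ^+ 2 - 4 * k * dz p (g t).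
  move=> k1; have -> : 0 = dx p (g s) ^+ 2 - dy p (g s) ^+ 2 - 4 * k * dz p (g s).
    by rewrite -/p dxx dyy dzz; ring.
  apply: (@ac_nondecreasing _
    (fun r => dx p (g r) ^+ 2 - dy p (g r) ^+ 2 - 4 * k * dz p (g r))).
  - exact: ltW.
  - apply: (@ac_cone k (c * dx p (g t))) => r sr rt.
    have h := dydx r sr rt.
    (* Averaging the two null monotonicities shows that [c * dx] is nondecreasing, so its final
       value bounds both [dx] and [dy] along the curve. *)
    have hm : c * dx p (g r) <= c * dx p (g t).
      have := null 1 r t (expr1n _ _) sr rt (lexx _).
      have := null (-1) r t N1 sr rt (lexx _); lra.
    split; last exact: le_trans hm.
    move/eqP: c1 h hm; rewrite sqrf_eq1 !ler_norml => /orP[]/eqP -> /andP[h1 h2] hm;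
      apply/andP; split; lra.
  - apply: filterS aegu => r h rst; have [dr ur] := h rst.
    exists (2 * (dx p (g r) * ((u r).1 - k * (u r).2) - dy p (g r) * ((u r).2 - k * (u r).1)));
      last exact: is_derive_cone.
    have sr : s <= r by move: rst; rewrite in_itv/= => /andP[/ltW].
    have rt : r <= t by move: rst; rewrite in_itv/= => /andP[_ /ltW].
    (* The factors are a null coordinate and the opposite null component of the control, each
       multiplied by c and thus nonnegative. *)
    rewrite mulr_ge0// (_ : _ - _ =
      (c * (dx p (g r) + k * dy p (g r))) * (c * (u r).1 - k * (c * (u r).2))).
      apply: mulr_ge0; first exact: null0.
      rewrite subr_ge0 (le_trans _ ur)// mulrA sqr1_mul_le//.
      by rewrite exprMn c1 k1 mulr1.
    transitivity (c ^+ 2 * (dx p (g r) * ((u r).1 - k * (u r).2) +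
       dy p (g r) * (k * (u r).1 - k ^+ 2 * (u r).2))); last by ring.
    by rewrite c1 k1; ring.
have := f0 1 (expr1n _ _); have := f0 (-1) N1.
by case: (ger0P (dz p (g t))) => h h1 h2; lra.
Qed.

(** Strict monotonicity asks for a positive derivative only inside the interval, so the vanishing of
    the null coordinates at the start is harmless. *)
Lemma cone_of_timelike_controls :
  {ae mu, forall r, r \in `[0, T] -> `|(u r).2| < (u r).1} -> cone_lt p (g t).
Proof.
move=> aeu.
have aegu : {ae mu, forall r, r \in `]s, t[ ->
   is_derive r 1 g ((u r).1 *: heisX (g r) + (u r).2 *: heisY (g r)) /\
   `|(u r).2| < (u r).1}.
  apply: filterS2 aeg aeu => r h1 h2 rst; split; [exact: h1|apply: h2].
  by apply: subset_itvW rst.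
(* The factor 1 takes the place of the orientation c, to match [ac_coord]. *)
have null k a b : k ^+ 2 = 1 -> s <= a -> a < b -> b <= t ->
    1 * (dx p (g a) + k * dy p (g a)) < 1 * (dx p (g b) + k * dy p (g b)).
  move=> k1 sa ab bt.
  apply: (ac_increasing (f := fun r => 1 * (dx p (g r) + k * dy p (g r)))) => //.
    exact: ac_coord.
  apply: filterS aegu => r h rab; have [|dr ur] := h; first by apply: subset_itvW rab.
  exists (1 * ((u r).1 + k * (u r).2)).
    rewrite mul1r -ltrBlDr sub0r (le_lt_trans _ ur)//.
    by rewrite -mulNr sqr1_mul_le// sqrrN.
  apply: is_derive_eq (is_deriveZ 1 (is_deriveD (is_derive_dx p dr)
    (is_deriveZ k (is_derive_dy p dr)))) _.
  by [].
have null0 k r : k ^+ 2 = 1 -> s < r -> r <= t -> 0 < dx p (g r) + k * dy p (g r).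
  move=> k1 sr rt; have := null k s r k1 (lexx _) sr rt.
  by rewrite -/p dxx dyy mulr0 addr0 mulr0 mul1r.
have N1 : (-1 : R) ^+ 2 = 1 by ring.
have dydx r : s < r -> r <= t -> `|dy p (g r)| < dx p (g r).
  move=> sr rt; have := null0 1 r (expr1n _ _) sr rt; have := null0 (-1) r N1 sr rt.
  by rewrite ltr_norml; lra.
split; first by apply: dydx.
have f0 k : k ^+ 2 = 1 -> 0 < dx p (g t) ^+ 2 - dy p (g t) ^+ 2 - 4 * k * dz p (g t).
  move=> k1; have -> : 0 = dx p (g s) ^+ 2 - dy p (g s) ^+ 2 - 4 * k * dz p (g s).
    by rewrite -/p dxx dyy dzz; ring.
  apply: (@ac_increasing _
    (fun r => dx p (g r) ^+ 2 - dy p (g r) ^+ 2 - 4 * k * dz p (g r))) => //.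
  - apply: (@ac_cone k (dx p (g t))) => r; rewrite le_eqVlt => /predU1P[<- _|sr rt].
      by rewrite -/p dxx dyy normr0 (le_trans (normr_ge0 _) (ltW (dydx t _ _))).
    have h := dydx r sr rt.
    have hm : dx p (g r) <= dx p (g t).
      move: rt; rewrite le_eqVlt => /predU1P[->//|rt].
      have := null 1 r t (expr1n _ _) (ltW sr) rt (lexx _).
      have := null (-1) r t N1 (ltW sr) rt (lexx _); lra.
    split; last exact: le_trans (ltW h) hm.
    by rewrite ger0_norm// (le_trans _ (ltW h)).
  - apply: filterS aegu => r h rst; have [dr ur] := h rst.
    exists (2 * (dx p (g r) * ((u r).1 - k * (u r).2) - dy p (g r) * ((u r).2 - k * (u r).1)));
      last exact: is_derive_cone.
    have sr : s < r by move: rst; rewrite in_itv/= => /andP[].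
    have rt : r <= t by move: rst; rewrite in_itv/= => /andP[_ /ltW].
    rewrite mulr_gt0// (_ : _ - _ = (dx p (g r) + k * dy p (g r)) * ((u r).1 - k * (u r).2)).
      apply: mulr_gt0; first exact: null0.
      rewrite subr_gt0 (le_lt_trans _ ur)// sqr1_mul_le//.
    transitivity (dx p (g r) * ((u r).1 - k * (u r).2) +
       dy p (g r) * (k * (u r).1 - k ^+ 2 * (u r).2)); last by ring.
    by rewrite k1; ring.
have := f0 1 (expr1n _ _); have := f0 (-1) N1.
by case: (ger0P (dz p (g t))) => h h1 h2; lra.
Qed.

End cone_necessity.

End cones.

(** * Straight horizontal segments *)

Section segments.
Context {R : realType}.
Notation mu := (@lebesgue_measure R).
Implicit Types (p q : heis R) (T : R) (g : R -> heis R) (u : R -> R * R).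
Implicit Types (v w : R * R) (C : set (R * R)).

Definition norm2 v : R := Num.sqrt (v.1 ^+ 2 + v.2 ^+ 2).
Definition hstep p v : heis R := heis_mul p (v, 0).
Definition hdir p v : heis R := v.1 *: heisX p + v.2 *: heisY p.

Lemma hstepE p v : hstep p v = p + hdir p v.
Proof.
case: p => [[x y] z]; case: v => [a b].
by rewrite /hstep /hdir /heis_mul; congr (_, _, _); rewrite /= /GRing.scale/=; field.
Qed.

(** This is why a Euclidean straight line can be horizontal: the direction with fixed control v does
    not change along it, so the line solves the horizontal equation with constant control. *)
Lemma hdir_along p v (r : R) : hdir (p + r *: hdir p v) v = hdir p v.
Proof.
case: p => [[x y] z]; case: v => [a b].
by rewrite /hdir; congr (_, _, _); rewrite /= /GRing.scale/=; field.
Qed.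

Lemma is_derive_affine (V : normedModType R) (a d : V) (s t : R) :
  is_derive t 1 (fun r : R => a + (r - s) *: d) d.
Proof.
have h : (fun h : R => h^-1 *: (((fun r : R => a + (r - s) *: d) \o shift t) (h *: 1) -
    (a + (t - s) *: d))) @ 0^' --> d.
  apply: (@cvg_trans _ (cst d @ (0 : R)^')); last exact: cvg_cst.
  apply: near_eq_cvg; near=> h.
  have h0 : h != 0 by near: h; exact: nbhs_dnbhs_neq.
  rewrite /= opprD addrACA subrr add0r -scalerBl [h *: 1]mulr1.
  rewrite (_ : h + t - s - (t - s) = h); last by ring.
  by rewrite scalerA mulVf// scale1r.
by split; [apply/cvg_ex; exists d; exact: h|apply/cvg_lim => //; exact: h].
Unshelve. all: by end_near. Qed.

Lemma bounded_Lfun_infty (f : R -> R) (M : R) : measurable_fun setT f ->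
  (forall x, `|f x| <= M) -> f \in Lfun mu +oo%E.
Proof.
move=> mf fM; rewrite inE; apply/andP; split; rewrite inE//=.
rewrite /finite_norm unlock; case: ifPn => // _.
apply: (@le_lt_trans _ _ M%:E); last exact: ltry.
by apply/ess_supP; apply: nearW => x /=; rewrite lee_fin.
Qed.

Lemma cst_Lfun_infty (A : set R) (c : R) : measurable A ->
  (cst c \_ A) \in Lfun mu +oo%E.
Proof.
move=> mA; apply: (@bounded_Lfun_infty _ `|c|).
  by apply/(measurable_restrictT _ mA); exact: measurable_cst.
by move=> x; rewrite patchE; case: ifP => // _; rewrite normr0.
Qed.

Lemma measurable_control T g u : horizontal T g u ->
  measurable_fun `[0, T] (fun t => (norm2 (u t))%:E).
Proof.
case=> T0 _ /andP[m1 _] /andP[m2 _] _; rewrite !inE in m1 m2.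
have m1' : measurable_fun `[0, T] (fst \o u).
  by apply/(measurable_restrictT _ (measurable_itv _)).
have m2' : measurable_fun `[0, T] (snd \o u).
  by apply/(measurable_restrictT _ (measurable_itv _)).
apply/measurable_EFinP; apply: (@measurableT_comp _ _ _ _ _ _ (@Num.sqrt R)).
  by apply: continuous_measurable_fun; exact: sqrt_continuous.
by apply: measurable_funD; apply: measurable_funX.
Qed.

Lemma horizontal_segment p v :
  [/\ horizontal 1 (fun t => p + (t - 0) *: hdir p v) (cst v),
      control_length 1 (cst v) = (norm2 v)%:E,
      p + (0 - 0) *: hdir p v = p & p + (1 - 0) *: hdir p v = hstep p v].
Proof.
split.
- split => //.
  + apply: (@lipschitz_ac _ _ _ _ _ `|hdir p v|) => l r _ lr _.
    rewrite !subr0 opprD addrACA subrr add0r -scalerBl normrZ mulrC.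
    by rewrite ger0_norm// subr_ge0.
  + by apply: cst_Lfun_infty; exact: measurable_itv.
  + by apply: cst_Lfun_infty; exact: measurable_itv.
  + apply: nearW => t _; apply: is_derive_eq (is_derive_affine _ _ _ _) _.
    by rewrite -/(hdir _ v) hdir_along.
- transitivity (\int[mu]_(t in `[0%R, 1%R]) (cst (norm2 v)%:E) t)%E; first by [].
  rewrite integral_cst//=.
  by rewrite lebesgue_measure_itv/= lte_fin ltr01 -EFinB subr0 mule1.
- by rewrite subr0 scale0r addr0.
- by rewrite subr0 scale1r hstepE.
Qed.

(* Written as a sum so that absolute continuity can be checked separately on the
   stopped curve and on the added segment. *)
Definition append_curve T g v (t : R) : heis R :=
  g (Num.min t T) + Num.max (t - T) 0 *: hdir (g T) v.
Definition append_control T u v (t : R) := if t <= T then u t else v.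

Lemma append_curve_le T g v t : t <= T -> append_curve T g v t = g t.
Proof.
move=> tT; rewrite /append_curve (min_idPl tT).
by rewrite (max_idPr _) ?subr_le0// scale0r addr0.
Qed.

Lemma append_curve_ge T g v t : T <= t ->
  append_curve T g v t = g T + (t - T) *: hdir (g T) v.
Proof.
move=> tT; rewrite /append_curve (min_idPr tT).
by rewrite (max_idPl _) ?subr_ge0.
Qed.

Lemma append_control_Lfun T (f : R -> R) (c : R) : 0 < T ->
  f \_ `[0, T] \in Lfun mu +oo%E ->
  (fun t => if t <= T then f t else c) \_ `[0, T + 1] \in Lfun mu +oo%E.
Proof.
move=> T0 fL.
(* Leaving T out of the second interval makes the two restrictions disjoint, so that their sum is
   the appended control. *)
rewrite (_ : _ \_ _ = f \_ `[0, T] + cst c \_ `]T, T + 1]).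
  apply: (Lfun_addr_closed mu (leey 1%E)).2 => //.
  by apply: cst_Lfun_infty; exact: measurable_itv.
(* [point] is the value of a restriction outside its set. *)
have p0 : point = 0 :> R by [].
apply/funext => t; rewrite !fctE !patchE !mem_setE !in_itv/=.
have [tT|Tt] := leP t T.
  rewrite andbT /= p0 addr0; case: (leP 0 t) => //= _.
  by rewrite (le_trans tT)// lerDl.
by rewrite andbF (le_trans (ltW T0) (ltW Tt))/= p0 add0r.
Qed.

Lemma horizontal_append T g u v : horizontal T g u ->
  horizontal (T + 1) (append_curve T g v) (append_control T u v).
Proof.
case=> T0 acg L1 L2 aeg; split.
- by rewrite ltr_wpDr.
- apply: acD.
    move=> e e0; have [d d0 H] := acg e e0; exists d => // n l r lr dis sd.
    (* Clipping all intervals at T keeps them disjoint and does not increase their total length. *)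
    apply: (H n (fun i => Num.min (l i) T) (fun i => Num.min (r i) T)).
    + move=> i; have [l0 [lri rT]] := lr i.
      split; first by rewrite le_min l0 ltW.
      split; last by rewrite ge_min lexx orbT.
      by rewrite le_min !ge_min lri lexx !orbT.
    + apply/trivIsetP => i j _ _ ij; move/trivIsetP : dis => /(_ i j I I ij).
      rewrite -!subset0 => sub t [+ +]; rewrite /= !in_itv/= => /andP[a1 a2] /andP[b1 b2].
      move: a1 a2 b1 b2; rewrite !lt_min !gt_min.
      case/orP => a1; last by move=> /andP[_ a2]; move: (lt_trans a1 a2); rewrite ltxx.
      move=> /andP[a2 a3]; case/orP => b1; last by move: (lt_trans b1 a3); rewrite ltxx.
      by move=> /andP[b2 b3]; apply: (sub t); rewrite /= !in_itv/= a1 a2 b1 b2.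
    + apply: le_lt_trans sd; apply: ler_sum => i _.
      have [_ [lri _]] := lr i.
      rewrite /Num.min; case: ifP => h1; case: ifP => h2; move: h1 h2;
        by case: ltP => // ? _; case: ltP => // ? _; lra.
  apply: (@lipschitz_ac _ _ _ _ _ `|hdir (g T) v|) => l r _ lr _.
  rewrite -scalerBl normrZ mulrC; apply: ler_wpM2l => //.
  rewrite /Num.max; case: ifP; case: ifP => h1 h2; move: h1 h2;
    by case: ltP => // ? _; case: ltP => // ? _; rewrite ler_norml; lra.
- rewrite (_ : fst \o _ = (fun t => if t <= T then (fst \o u) t else v.1)).
    exact: append_control_Lfun.
  by apply/funext => t; rewrite /append_control /=; case: ifP.
- rewrite (_ : snd \o _ = (fun t => if t <= T then (snd \o u) t else v.2)).
    exact: append_control_Lfun.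
  by apply/funext => t; rewrite /append_control /=; case: ifP.
(* The curve may have a corner at the junction T, a null set. *)
- have aeT : {ae mu, forall t, t != T}.
    have : mu.-negligible [set T].
      by apply/negligibleP; [exact: measurable_set1|exact: lebesgue_measure_set1].
    by apply: negligibleS => t /= /negP; rewrite negbK => /eqP.
  apply: filterS2 aeT aeg => t tT dg; rewrite in_itv/= => /andP[t0 tT1].
  have [ltT|leT] := ltP t T.
    rewrite /append_control (ltW ltT) append_curve_le ?(ltW ltT)//.
    have := dg; rewrite in_itv/= t0 ltT => /(_ isT).
    apply: near_eq_is_derive; near=> s; rewrite append_curve_le// ltW//.
    by near: s; exact: lt_nbhsl.
  have Tt : T < t by rewrite lt_neqAle eq_sym tT leT.
  rewrite /append_control leNgt Tt/= append_curve_ge ?(ltW Tt)//.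
  rewrite -/(hdir _ v) hdir_along.
  apply: (near_eq_is_derive _ (is_derive_affine (g T) (hdir (g T) v) T t)).
  near=> s; rewrite append_curve_ge// ltW//.
  by near: s; exact: lt_nbhsr.
Unshelve. all: by end_near. Qed.

Lemma append_controls_in T u v C : 0 < T -> C v ->
  {ae mu, forall t, t \in `[0, T] -> C (u t)} ->
  {ae mu, forall t, t \in `[0, T + 1] -> C (append_control T u v t)}.
Proof.
move=> T0 Cv; apply: filterS => t Cu; rewrite in_itv/= => /andP[t0 _].
by rewrite /append_control; case: ifP => // tT; apply: Cu; rewrite in_itv/= t0 tT.
Qed.

Lemma control_length_append T g u v : horizontal T g u ->
  control_length (T + 1) (append_control T u v) = (control_length T u + (norm2 v)%:E)%E.
Proof.
move=> hor; have mh := measurable_control (horizontal_append v hor).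
have T0 : 0 < T by case: hor.
have E : `[0, T + 1]%classic = `[0, T] `|` `]T, T + 1].
  by rewrite -itv_bndbnd_setU// bnd_simp; [exact: ltW|rewrite lerDl].
rewrite /control_length E in mh *.
rewrite (ge0_integral_setU mu (measurable_itv _) (measurable_itv _) mh).
- congr (_ + _)%E.
    by apply: eq_integral => t; rewrite inE/= in_itv/= /append_control => /andP[_ ->].
  transitivity (\int[mu]_(t in `]T, (T + 1)%R]) (cst (norm2 v)%:E) t)%E.
    apply: eq_integral => t.
    by rewrite inE/= in_itv/= /append_control => /andP[Tt _]; rewrite leNgt Tt/=.
  rewrite integral_cst//=.
  rewrite lebesgue_measure_itv/= lte_fin ltrDl ltr01 -EFinB addrAC subrr add0r.
  by rewrite mule1.
- by move=> t _; rewrite lee_fin sqrtr_ge0.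
- rewrite disj_set2E; apply/eqP; rewrite -subset0 => t /=; rewrite !in_itv/=.
  by move=> [/andP[_ tT] /andP[Tt _]]; move: (le_lt_trans tT Tt); rewrite ltxx.
Qed.

Lemma curve_segment C p v : C v ->
  exists T g, [/\ curve_with_controls_in C T g, g 0 = p & g T = hstep p v].
Proof.
move=> Cv; have [hor _ h0 h1] := horizontal_segment p v.
exists 1, (fun t => p + (t - 0) *: hdir p v); split => //.
by exists (cst v) => //; exact: nearW.
Qed.

Lemma curve_append C T g v : C v -> curve_with_controls_in C T g ->
  exists T' g', [/\ curve_with_controls_in C T' g', g' 0 = g 0 & g' T' = hstep (g T) v].
Proof.
move=> Cv [u hor Cu]; have T0 : 0 < T by case: hor.
exists (T + 1), (append_curve T g v); split.
- by exists (append_control T u v); [exact: horizontal_append|exact: append_controls_in].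
- by rewrite append_curve_le// ltW.
- by rewrite append_curve_ge ?lerDl// addrAC subrr add0r scale1r hstepE.
Qed.

Lemma sr_dist_hstep p v : (sr_dist p (hstep p v) <= (norm2 v)%:E)%E.
Proof.
have [hor len h0 h1] := horizontal_segment p v.
apply: ereal_inf_lbound; exists 1, (fun t => p + (t - 0) *: hdir p v), (cst v).
by split.
Qed.

(** The instance of the triangle inequality behind the two-segment estimates: appending the segment
    to any curve from p to q adds exactly [norm2 v] to its length. *)
Lemma sr_dist_hstepr p q v :
  (sr_dist p (hstep q v) <= sr_dist p q + (norm2 v)%:E)%E.
Proof.
rewrite -leeBlDr//; apply: le_ereal_inf_tmp => _ [T [g [u [hor g0 gT ->]]]].
rewrite leeBlDr// -(control_length_append v hor).
have T0 : 0 < T by case: hor.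
apply: ereal_inf_lbound; exists (T + 1), (append_curve T g v), (append_control T u v).
split => //; first exact: horizontal_append.
- by rewrite append_curve_le// ltW.
- by rewrite append_curve_ge ?lerDl// addrAC subrr add0r scale1r -gT hstepE.
Qed.

End segments.

(** * Displacement of short horizontal curves *)

Section length_bound.
Context {R : realType}.
Notation mu := (@lebesgue_measure R).
Implicit Types (p q : heis R) (T : R) (g : R -> heis R) (u : R -> R * R).

(** The bound on k makes the integral Lipschitz in its upper limit, hence absolutely continuous;
    Lebesgue differentiation gives the derivative. *)
Lemma bounded_primitive (k : R -> R) (T M : R) : 0 < T ->
  measurable_fun `[0, T] k -> (forall t, 0 <= k t <= M) ->
  exists F : R -> R, [/\ absolutely_continuous 0 T F, F 0 = 0,
    (F T)%:E = (\int[mu]_(t in `[0%R, T]) (k t)%:E)%E &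
    {ae mu, forall t, t \in `]0, T[ -> is_derive t 1 F (k t)}].
Proof.
move=> T0 mk k0M.
have ik : mu.-integrable `[0, T] (EFin \o k).
  apply: measurable_bounded_integrable => //.
    by rewrite /= lebesgue_measure_itv/= lte_fin T0 -EFinB ltry.
  exists M; split; first exact: num_real.
  move=> N MN t _ /=; have /andP[kt0 ktM] := k0M t.
  by rewrite ger0_norm// (le_trans ktM)// ltW.
(* Extended by 0 off [[0, T]], k becomes integrable on the whole line, where the differentiation
   theorem is applied. *)
pose f := k \_ `[0, T].
have f0M t : 0 <= f t <= M.
  rewrite /f patchE; case: ifP => // _; rewrite lexx/=.
  by have /andP[/le_trans] := k0M 0; apply.
have fE t : 0 <= t <= T -> f t = k t.
  by move=> t0T; rewrite /f patchE mem_set//= in_itv.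
have iff : mu.-integrable setT (EFin \o f).
  rewrite /f -restrict_EFin; apply/integrable_restrict => //=.
  by rewrite setTI.
have itf (i : interval R) : mu.-integrable [set` i] (EFin \o f).
  by apply: integrableS iff => //; exact: measurable_itv.
pose F t := (\int[mu]_(s in [set` Interval (BLeft 0) (BRight t)]) f s)%R.
exists F; split.
- apply: (@lipschitz_ac _ _ _ _ _ M) => l r l0 lr rT.
  rewrite /F Rintegral_itvB//.
  apply: (le_trans (le_normr_Rintegral _ _)) => //.
  apply: (@le_trans _ _ (\int[mu]_(x in `]l, r]) (cst M x))%R).
    apply: le_Rintegral; first exact: measurable_itv.
    + exact: (integrable_abse (itf _)).
    + apply: measurable_bounded_integrable => //.
        by rewrite /= lebesgue_measure_itv/=; case: ifP => _; rewrite ?ltry// -EFinB ltry.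
      by exists `|M|; split => // N MN t _ /=; exact: ltW.
    + by move=> t _ /=; have /andP[? ?] := f0M t; rewrite ger0_norm.
  rewrite Rintegral_cst//= lebesgue_measure_itv/= lte_fin.
  case: ltP => rl /=; rewrite ?mulr0// mulr_ge0// ?subr_ge0//.
  by have /andP[/le_trans] := f0M 0; apply.
- by rewrite /F set_itv1 Rintegral_set1.
- rewrite /F /Rintegral fineK; last exact: (integrable_fin_num _ (itf _)).
  by apply: eq_integral => t; rewrite inE/= in_itv/= => /fE ->.
- have locf : locally_integrable [set: R] f.
    by apply: integrable_locally => //; exact: measurable_itv.
  apply: filterS (FTC1 (a := BLeft 0) (fun y => itf _) locf) => t dF t0T.
  have t0' : (BLeft 0%R < BRight t)%E.
    by move: t0T; rewrite in_itv/= lte_fin => /andP[].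
  have [dF1 dF2] := dF t0'.
  rewrite -fE; last by move: t0T; rewrite in_itv/= => /andP[/ltW-> /ltW->].
  by split; [exact: dF1|rewrite -derive1E; exact: dF2].
Qed.

Lemma control_bounded T (f : R -> R) :
  f \_ `[0, T] \in Lfun mu +oo%E ->
  exists M, {ae mu, forall t, t \in `[0, T] -> `|f t| <= M}.
Proof.
move=> /andP[_]; rewrite inE/= /finite_norm unlock.
(* The norm of index +oo is an essential supremum only on a space of positive measure. *)
have -> : (0 < mu [set: R])%E.
  apply: (@lt_le_trans _ _ (mu `[0, 1]%classic)).
    by rewrite /= lebesgue_measure_itv/= lte_fin ltr01 -EFinB subr0 lte_fin.
  by apply: le_measure => //; rewrite inE//; exact: measurable_itv.
move=> fM; have [|M HM] := @ess_supr_bounded _ _ _ mu (fun t => `|(f \_ `[0, T]) t|).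
  exact: fM.
exists M; apply: filterS HM => t + tT; rewrite patchE mem_set//.
Qed.

Lemma norm2_ge (v : R * R) : `|v.1| <= norm2 v /\ `|v.2| <= norm2 v.
Proof.
by split; rewrite -sqrtr_sqr ler_wsqrtr// ?lerDl ?lerDr sqr_ge0.
Qed.

Lemma norm2_le (v : R * R) : norm2 v <= `|v.1| + `|v.2|.
Proof.
rewrite -[leRHS]ger0_norm ?addr_ge0// -sqrtr_sqr ler_wsqrtr//.
rewrite sqrrD !real_normK ?num_real// lerD2r lerDl.
by rewrite mulrn_wge0// mulr_ge0.
Qed.

(* The control is only essentially bounded: truncating its norm at an essential
   bound changes it on a null set and makes its primitive F Lipschitz. *)
Lemma horizontal_displacement T g u (r : R) : horizontal T g u ->
  (control_length T u < r%:E)%E ->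
  [/\ `|dx (g 0) (g T)| <= r, `|dy (g 0) (g T)| <= r &
      `|dz (g 0) (g T)| <= r ^+ 2].
Proof.
move=> hor Lr; case: (hor) => T0 acg L1 L2 aeg.
have [M1 u1M] := control_bounded L1; have [M2 u2M] := control_bounded L2.
pose k t := Num.min (norm2 (u t)) `|M1 + M2|.
have mn := measurable_control hor.
have mk : measurable_fun `[0, T] k.
  by apply: measurable_minr; [exact/measurable_EFinP|exact: measurable_cst].
have k0M t : 0 <= k t <= `|M1 + M2|.
  by rewrite /k le_min sqrtr_ge0 normr_ge0 ge_min lexx orbT.
have [F [acF F0 FT dF]] := bounded_primitive T0 mk k0M.
have FTr : F T <= r.
  rewrite -lee_fin FT (le_trans _ (ltW Lr))//.
  apply: ge0_le_integral => //.
  - by move=> t _; rewrite lee_fin; have /andP[] := k0M t.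
  - by apply/measurable_EFinP.
  - by move=> t _; rewrite lee_fin ge_min lexx.
have aeall : {ae mu, forall t, t \in `]0, T[ ->
    [/\ is_derive t 1 g ((u t).1 *: heisX (g t) + (u t).2 *: heisY (g t)),
        is_derive t 1 F (k t), `|(u t).1| <= k t & `|(u t).2| <= k t]}.
  apply: filterS2 (filterI aeg dF) (filterI u1M u2M) => t [h1 h2] [h3 h4] t0T.
  have t0T' : t \in `[0, T] by apply: subset_itvW t0T.
  have [n1 n2] := norm2_ge (u t).
  have kE : k t = norm2 (u t).
    apply/min_idPl; rewrite (le_trans (norm2_le _))// (le_trans _ (ler_norm _))//.
    by apply: lerD; [exact: h3|exact: h4].
  by split; [exact: h1|exact: h2|rewrite kE|rewrite kE].
set p := g 0.
have Fmono t : 0 <= t -> t <= T -> F t <= r.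
  move=> t0 tT; apply: le_trans FTr; apply: ac_nondecreasing => //.
    exact: ac_sub_itv acF.
  apply: filterS aeall => s + st => -[|_ dFs _ _]; first by apply: subset_itvW st.
  by exists (k s) => //; have /andP[] := k0M s.
(* Both c F + f and c F - f start at 0 and have an a.e. nonnegative derivative. *)
have coord (c : R) (f : R -> R) (w : R -> R) t : f 0 = 0 -> 
    absolutely_continuous 0 T f -> 0 <= t -> t <= T ->
    {ae mu, forall t, t \in `]0, T[ ->
      [/\ is_derive t 1 F (k t), is_derive t 1 f (w t) & `|w t| <= c * k t]} ->
    `|f t| <= c * F t.
  move=> f0 acf t0 tT aef.
  have sgn (e : R) : e ^+ 2 = 1 -> 0 <= c * F t + e * f t.
    move=> e1; have -> : 0 = c * F 0 + e * f 0 by rewrite F0 f0 !mulr0 addr0.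
    apply: (ac_nondecreasing (f := fun t => c * F t + e * f t)) => //.
      apply: (ac_sub_itv (lexx _) tT); apply: acD.
        apply: (@ac_dominated _ _ _ F _ _ _ `|c|) => // l s _ _ _.
        by rewrite -mulrBr normrM.
      apply: (@ac_dominated _ _ _ f _ _ _ `|e|) => // l s _ _ _.
      by rewrite -mulrBr normrM.
    apply: filterS aef => s + st => -[|dFs dfs ws]; first by apply: subset_itvW st.
    exists (c * k s + e * w s).
      rewrite -lerBlDr sub0r (le_trans _ ws)// -mulNr sqr1_mul_le//.
      by rewrite sqrrN.
    by apply: is_derive_eq (is_deriveD (is_deriveZ c dFs) (is_deriveZ e dfs)) _.
  have := sgn 1 (expr1n _ _); have := sgn (-1) _; rewrite sqrrN expr1n => /(_ erefl).
  by rewrite ler_norml => h1 h2; apply/andP; split; lra.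
have dx0 : dx p p = 0 by rewrite /dx subrr.
have dy0 : dy p p = 0 by rewrite /dy subrr.
have hx t : 0 <= t -> t <= T -> `|dx p (g t)| <= r.
  move=> t0 tT; apply: le_trans (Fmono t t0 tT); rewrite -[F t]mul1r.
  apply: (coord _ (fun t => dx p (g t)) (fun t => (u t).1)) => //.
    by apply: (@ac_dominated _ _ _ g _ _ _ 1) => // l s _ _ _; rewrite mul1r dx_lip.
  apply: filterS aeall => s h /h[dg dFs h1 h2]; split => //; last by rewrite mul1r.
  exact: is_derive_dx.
have hy t : 0 <= t -> t <= T -> `|dy p (g t)| <= r.
  move=> t0 tT; apply: le_trans (Fmono t t0 tT); rewrite -[F t]mul1r.
  apply: (coord _ (fun t => dy p (g t)) (fun t => (u t).2)) => //.
    by apply: (@ac_dominated _ _ _ g _ _ _ 1) => // l s _ _ _; rewrite mul1r dy_lip.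
  apply: filterS aeall => s h /h[dg dFs h1 h2]; split => //; last by rewrite mul1r.
  exact: is_derive_dy.
split; [by apply: hx => //; exact: ltW|by apply: hy => //; exact: ltW|].
have r0 : 0 <= r by rewrite (le_trans _ (hx 0 _ _))// ltW.
(* As [dx] and [dy] stay below r, the area rate is at most r k; a second factor r comes from the
   total length. *)
apply: (@le_trans _ _ (r * F T)); last by rewrite expr2 ler_wpM2l.
apply: (coord _ (fun t => dz p (g t))
  (fun t => (dx p (g t) * (u t).2 - dy p (g t) * (u t).1) / 2)) => //.
- by rewrite /dz -/p; field.
- by apply: (@ac_dominated _ _ _ g _ _ _ (1 + `|p|)) => // l s _ _ _; exact: dz_lip.
- exact: ltW.
apply: filterS aeall => s + sT => /(_ sT)[dg dFs h1 h2]; split => //.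
  exact: is_derive_dz.
move: sT; rewrite in_itv/= => /andP[/ltW s0 /ltW sT].
rewrite normrM [X in _ * X]ger0_norm ?invr_ge0//.
have := ler_pM (normr_ge0 _) (normr_ge0 _) (hx s s0 sT) h2.
have := ler_pM (normr_ge0 _) (normr_ge0 _) (hy s s0 sT) h1.
have := ler_normB (dx p (g s) * (u s).2) (dy p (g s) * (u s).1).
by rewrite !normrM; lra.
Qed.

End length_bound.

(** * Causal structure *)

Section causality.
Context {R : realType}.
Notation mu := (@lebesgue_measure R).
Implicit Types (p q : heis R) (T : R) (g : R -> heis R) (u : R -> R * R).
Implicit Types (v w : R * R).

(** * The causal and chronological relations as polynomial inequalities *)

Lemma cone_le_refl p : cone_le p p.
Proof.
by rewrite /cone_le /dx /dy /dz !subrr mul0r subrr normr0 mulr0.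
Qed.

Lemma dx_opp p q : dx q p = - dx p q. Proof. by rewrite /dx opprB. Qed.
Lemma dy_opp p q : dy q p = - dy p q. Proof. by rewrite /dy opprB. Qed.
Lemma dz_opp p q : dz q p = - dz p q. Proof. by rewrite /dz; field. Qed.

(* On the boundary |dy| = |dx| of the cone the denominator vanishes, and x / 0 = 0
   gives the right value: there dz = 0 and the two steps are the same. *)
Definition slope p q : R := 4 * dz p q / (dx p q ^+ 2 - dy p q ^+ 2).
(** With k the slope, the first step takes the share (1 - k) / 2 of a = x + y and (1 + k) / 2 of b =
    x - y, and the second step takes the rest. The two edges then span a triangle of signed area k a
    b / 4, which equals z exactly for k = 4 z / (a b). *)
Definition step1 p q : R * R :=
  ((dx p q - slope p q * dy p q) / 2, (dy p q - slope p q * dx p q) / 2).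
Definition step2 p q : R * R :=
  ((dx p q + slope p q * dy p q) / 2, (dy p q + slope p q * dx p q) / 2).

Lemma two_steps p q : cone_le p q -> q = hstep (hstep p (step1 p q)) (step2 p q).
Proof.
move=> [h1 h2].
have kE : slope p q * (dx p q ^+ 2 - dy p q ^+ 2) = 4 * dz p q.
  rewrite /slope; have [d0|d0] := eqVneq (dx p q ^+ 2 - dy p q ^+ 2) 0.
    move: h2; rewrite d0 mulr0 pmulr_rle0// normr_le0 => /eqP ->.
    by rewrite mulr0.
  by rewrite divfK.
move: kE; rewrite /step1 /step2; move: (slope p q) => k {h1 h2}.
case: p q => [[x y] z] [[x' y'] z']; rewrite /dx /dy /dz /hstep /heis_mul /= => kE.
by congr (_, _, _); [field|field|move: kE; lra].
Qed.

Lemma slope_le1 p q : cone_le p q -> `|slope p q| <= 1.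
Proof.
move=> [h1 h2]; rewrite /slope normrM normfV normrM (ger0_norm (_ : 0 <= 4)) //.
have d0 : 0 <= dx p q ^+ 2 - dy p q ^+ 2 by rewrite (le_trans _ h2)// mulr_ge0.
rewrite (ger0_norm d0); have [->|dn0] := eqVneq (dx p q ^+ 2 - dy p q ^+ 2) 0.
  by rewrite invr0 mulr0.
by rewrite ler_pdivrMr ?mul1r// lt_def dn0.
Qed.

Lemma steps_le p q : cone_le p q ->
  `|(step1 p q).2| <= (step1 p q).1 /\ `|(step2 p q).2| <= (step2 p q).1.
Proof.
move=> h; have := slope_le1 h; case: h => + _; rewrite /step1 /step2 /=.
move: (dx p q) (dy p q) (slope p q) => x y k.
rewrite !ler_norml => /andP[h1 h2] /andP[h3 h4].
(* The four products are twice the null coordinates of the two steps. *)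
have a1 : 0 <= (x - y) * (1 - k) by rewrite mulr_ge0 ?subr_ge0.
have a2 : 0 <= (x - y) * (1 + k) by rewrite mulr_ge0; lra.
have a3 : 0 <= (x + y) * (1 - k) by rewrite mulr_ge0; lra.
have a4 : 0 <= (x + y) * (1 + k) by rewrite mulr_ge0; lra.
by split; apply/andP; split; lra.
Qed.

(** A causal control needs a positive first component, so neither step may vanish. The risk is slope
    1 or -1 together with |dy| = dx, and there the default slope 0 intervenes. *)
Lemma steps_gt0 p q : cone_le p q -> p <> q ->
  0 < (step1 p q).1 /\ 0 < (step2 p q).1.
Proof.
move=> h pq; have [h1 h2] := steps_le h.
have x0 : 0 < dx p q.
  rewrite lt_def (le_trans _ h.1)// andbT; apply/negP => /eqP x0.
  case: h => /[!x0]; rewrite normr_le0 => /eqP y0.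
  rewrite y0 expr0n subrr pmulr_rle0// normr_le0 => /eqP z0; apply: pq.
  move: x0 y0 z0; case: p q {h1 h2} => [[x y] z] [[x' y'] z']; rewrite /dx /dy /dz /= => a b c.
  congr (_, _, _); [lra|lra|].
  have xx : x' = x by lra.
  have yy : y' = y by lra.
  by move: c; rewrite xx yy subrr mul0r; lra.
have k1 := slope_le1 h.
have : `|slope p q * dy p q| < dx p q.
  rewrite normrM; have [e|ne] := eqVneq `|dy p q| (dx p q).
    have : slope p q = 0.
      by rewrite /slope -e real_normK ?num_real// subrr invr0 mulr0.
    by move=> ->; rewrite normr0 mul0r.
  apply: (@le_lt_trans _ _ `|dy p q|); first by rewrite ler_piMl.
  by rewrite lt_neqAle ne h.1.
by rewrite ltr_norml /step1 /step2 /= => /andP[a b]; split; lra.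
Qed.

Lemma steps_lt p q : cone_lt p q ->
  `|(step1 p q).2| < (step1 p q).1 /\ `|(step2 p q).2| < (step2 p q).1.
Proof.
move=> [h1 h2].
have d0 : 0 < dx p q ^+ 2 - dy p q ^+ 2 by rewrite (le_lt_trans _ h2)// mulr_ge0.
have : `|slope p q| < 1.
  rewrite /slope normrM normfV normrM (ger0_norm (_ : 0 <= 4)) // (gtr0_norm d0).
  by rewrite ltr_pdivrMr ?mul1r.
move: h1; rewrite /step1 /step2 /=.
move: (dx p q) (dy p q) (slope p q) => x y k.
rewrite !ltr_norml => /andP[h1 h1'] /andP[h3 h4].
have a1 : 0 < (x - y) * (1 - k) by rewrite mulr_gt0 ?subr_gt0.
have a2 : 0 < (x - y) * (1 + k) by rewrite mulr_gt0; lra.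
have a3 : 0 < (x + y) * (1 - k) by rewrite mulr_gt0; lra.
have a4 : 0 < (x + y) * (1 + k) by rewrite mulr_gt0; lra.
by split; apply/andP; split; lra.
Qed.

Lemma cone_ltW p q : cone_lt p q -> cone_le p q.
Proof. by move=> [/ltW ? /ltW ?]. Qed.

Lemma causal_leP p q : causal_le p q <-> cone_le p q.
Proof.
split=> [[->|[T [g [[u hor aeu] <- <-]]]]|h]; first exact: cone_le_refl.
- have T0 : 0 < T by case: hor.
  have := @cone_of_causal_controls _ _ _ _ 0 T hor (lexx _) T0 (lexx _) 1 (expr1n _ _).
  rewrite /cone_le !mul1r; apply.
  by apply: filterS aeu => t h /h[]; rewrite mul1r.
- have [|pq] := pselect (p = q); [by left|right].
  have [v2 w2] := steps_le h; have [v1 w1] := steps_gt0 h pq.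
  have [T [g [cg g0 gT]]] :=
    @curve_segment _ [set v | `|v.2| <= v.1 /\ 0 < v.1] p _ (conj v2 v1).
  have [T' [g' [cg' g'0 g'T]]] := curve_append (conj w2 w1) cg.
  exists T', g'; split; [exact: cg'|by rewrite g'0|].
  by rewrite g'T gT -two_steps.
Qed.

Lemma chron_ltP p q : chron_lt p q <-> cone_lt p q.
Proof.
split=> [[T [g [[u hor aeu] <- <-]]]|h].
  have T0 : 0 < T by case: hor.
  exact: (cone_of_timelike_controls hor (lexx _) T0 (lexx _)).
have [v2 w2] := steps_lt h.
have [T [g [cg g0 gT]]] := @curve_segment _ [set v | `|v.2| < v.1] p _ v2.
have [T' [g' [cg' g'0 g'T]]] := curve_append w2 cg.
exists T', g'; split; [exact: cg'|by rewrite g'0|].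
by rewrite g'T gT -two_steps//; exact: cone_ltW.
Qed.

(** * Distance and length estimates along causal curves *)

Lemma sr_dist_two_steps o p q : cone_le p q ->
  (sr_dist o q <= sr_dist o p + (2 * dx p q)%:E)%E.
Proof.
move=> h; have [v2 w2] := steps_le h.
rewrite {1}(two_steps h); apply: (le_trans (sr_dist_hstepr _ _ _)).
apply: (le_trans (leeD (sr_dist_hstepr _ _ _) (lexx _))).
rewrite -addeA leeD2l// -EFinD lee_fin.
(* A causal step v has norm at most |v.1| + |v.2|, hence at most 2 v.1, and the first components of
   the two steps add up to [dx p q]. *)
apply: (le_trans (lerD (norm2_le _) (norm2_le _))).
have := le_trans (normr_ge0 _) v2; have := le_trans (normr_ge0 _) w2.
move=> w1 v1; rewrite (ger0_norm v1) (ger0_norm w1); move: v2 w2.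
by rewrite /step1 /step2 /=; lra.
Qed.

Lemma sr_dist_refl p : (sr_dist p p <= 0)%E.
Proof.
have := sr_dist_hstep p (0, 0).
rewrite hstepE /hdir !scale0r !addr0 /norm2/= expr0n addr0 sqrtr0; exact.
Qed.

Lemma sr_dist_cone p q : cone_le p q -> (sr_dist p q <= (2 * dx p q)%:E)%E.
Proof.
move=> h; apply: (le_trans (sr_dist_two_steps p h)).
by rewrite -[leRHS]add0e leeD2r// sr_dist_refl.
Qed.

Lemma hstepN p v : hstep (hstep p v) (- v) = p.
Proof.
case: p v => [[x y] z] [a b].
by rewrite /hstep /heis_mul; congr (_, _, _); rewrite /=; field.
Qed.

Lemma norm2N v : norm2 (- v) = norm2 v.
Proof. by rewrite /norm2 /= !sqrrN. Qed.

(** The two steps from q to p are walked backwards, a step by -v undoing the step by v. *)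
Lemma sr_dist_cone_rev p q : cone_le q p -> (sr_dist p q <= (2 * dx q p)%:E)%E.
Proof.
move=> h; have [v2 w2] := steps_le h; have E := two_steps h.
have E' : q = hstep (hstep p (- step2 q p)) (- step1 q p).
  by move: (step1 q p) (step2 q p) E => v w ->; rewrite !hstepN.
rewrite {1}E'.
apply: (le_trans (sr_dist_hstepr _ _ _)).
apply: (le_trans (leeD (sr_dist_hstep _ _) (lexx _))).
rewrite !norm2N -EFinD lee_fin.
apply: (le_trans (lerD (norm2_le _) (norm2_le _))).
have := le_trans (normr_ge0 _) v2; have := le_trans (normr_ge0 _) w2.
move=> w1 v1; rewrite (ger0_norm v1) (ger0_norm w1); move: v2 w2.
by rewrite /step1 /step2 /=; lra.
Qed.

Lemma partition_sum_le T g (c : R) s a :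
  (forall x y, a <= x -> x < y -> y <= T ->
    (sr_dist (g x) (g y) <= (c * ((g y).1.1 - (g x).1.1))%:E)%E) ->
  itv_partition a T s ->
  (\sum_(i < size s) sr_dist (g (nth T (a :: s) i)) (g (nth T s i)) <=
    (c * ((g T).1.1 - (g a).1.1))%:E)%E.
Proof.
elim: s a => [|b s IH] a H.
  by move=> /itv_partition_nil <-; rewrite big_ord0 subrr mulr0.
move=> ps; have := ps; case => /= /andP[ab _] _.
have ps' := itv_partition_cons ps; have bT := itv_partition_le ps'.
rewrite big_ord_recl /=.
have -> : c * ((g T).1.1 - (g a).1.1) =
  c * ((g b).1.1 - (g a).1.1) + c * ((g T).1.1 - (g b).1.1) by ring.
rewrite EFinD; apply: leeD; first exact: H.
by apply: IH => // x y bx; apply: H; exact: le_trans (ltW ab) bx.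
Qed.

(* Each chord is compared with the two segments joining its end points, not with
   the curve itself, so the length of the curve is never computed. *)
Lemma sr_length_causal T g : causal T g ->
  (sr_length T g <= (2 * `|(g T).1.1 - (g 0).1.1|)%:E)%E.
Proof.
move=> cg; apply: ge_ereal_sup => _ [s ps <-].
have [c [c1 [u hor aeu]]] : exists c : R, c ^+ 2 = 1 /\ exists2 u, horizontal T g u &
    {ae mu, forall r, r \in `[0, T] -> `|(u r).2| <= c * (u r).1}.
  case: cg => -[u hor aeu].
    exists 1; split; first exact: expr1n.
    by exists u => //; apply: filterS aeu => r h /h[]; rewrite mul1r.
  exists (-1); split; first by rewrite sqrrN expr1n.
  by exists u => //; apply: filterS aeu => r h /h[]; rewrite mulN1r.
apply: (@le_trans _ _ ((2 * c) * ((g T).1.1 - (g 0).1.1))%:E); last first.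
  by rewrite lee_fin -mulrA ler_wpM2l// sqr1_mul_le.
apply: partition_sum_le => // x y x0 xy yT.
have [h1 h2] := cone_of_causal_controls hor x0 xy yT c1 aeu.
rewrite -/(dx (g x) (g y)).
move/eqP: c1 h1; rewrite sqrf_eq1 => /orP[]/eqP ->.
  rewrite mul1r mulr1 => h1; exact: sr_dist_cone.
move=> h1; rewrite -mulrA mulN1r -dx_opp; apply: sr_dist_cone_rev.
split; rewrite (dx_opp (g x) (g y)) (dy_opp (g x) (g y)) ?(dz_opp (g x) (g y)).
  by rewrite normrN -mulN1r.
by rewrite normrN !sqrrN.
Qed.

Lemma curves_bounded_of_x (A : set (heis R)) (M : R) :
  (forall p, A p -> `|p.1.1| <= M) -> curves_bounded_in A.
Proof.
move=> AM; exists (4 * `|M| + 1); first by rewrite ltr_wpDl// mulr_ge0.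
move=> T g cg gA; apply: (le_trans (sr_length_causal cg)).
have T0 : 0 < T by case: cg => -[u []].
have h0 : A (g 0) by apply: gA; rewrite in_itv/= lexx ltW.
have hT : A (g T) by apply: gA; rewrite in_itv/= lexx ltW.
rewrite lee_fin; have := AM _ h0; have := AM _ hT.
by have := ler_normB (g T).1.1 (g 0).1.1; have := ler_norm M; lra.
Qed.

Lemma heis_sr_compatible : sr_compatible R.
Proof.
move=> q; exists (ball q 1); first exact: nbhsx_ballx.
apply: (@curves_bounded_of_x _ (`|q.1.1| + 1)) => p [[+ _] _].
rewrite /ball/= => h; have := ler_normB q.1.1 (q.1.1 - p.1.1).
by rewrite subKr; lra.
Qed.

Lemma heis_non_totally_imprisoning : non_totally_imprisoning R.
Proof.
move=> K /compact_bounded [M [_ HM]].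
apply: (@curves_bounded_of_x _ (M + 1)) => p Kp.
have [h _ _] := coord_norm_le p; apply: (le_trans h).
by apply: HM Kp; rewrite ltrDl.
Qed.

(** * Closedness of the causal relation and openness of the chronological one *)

Section continuity.
Context {X : topologicalType} (f h : X -> heis R).
Context (cf : continuous f) (ch : continuous h).

Let c1 (k : X -> heis R) : continuous k -> continuous (fun z => (k z).1.1).
Proof. by move=> ck z; apply: (cvg_comp _ _ (cvg_comp _ _ (ck z) cvg_fst) cvg_fst). Qed.
Let c2 (k : X -> heis R) : continuous k -> continuous (fun z => (k z).1.2).
Proof. by move=> ck z; apply: (cvg_comp _ _ (cvg_comp _ _ (ck z) cvg_fst) cvg_snd). Qed.
Let c3 (k : X -> heis R) : continuous k -> continuous (fun z => (k z).2).
Proof. by move=> ck z; apply: (cvg_comp _ _ (ck z) cvg_snd). Qed.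

Lemma continuous_dx : continuous (fun z => dx (f z) (h z)).
Proof. by move=> z; apply: cvgB; exact: c1. Qed.

Lemma continuous_dy : continuous (fun z => dy (f z) (h z)).
Proof. by move=> z; apply: cvgB; exact: c2. Qed.

Lemma continuous_dz : continuous (fun z => dz (f z) (h z)).
Proof.
move=> z; apply: cvgB; first by apply: cvgB; exact: c3.
apply: cvgM; last exact: cvg_cst.
by apply: cvgB; apply: cvgM; [exact: c1|exact: c2|exact: c1|exact: c2].
Qed.

Lemma continuous_null_slack :
  continuous (fun z => dx (f z) (h z) - `|dy (f z) (h z)|).
Proof.
by move=> z; apply: cvgB; [exact: continuous_dx|apply: cvg_norm; exact: continuous_dy].
Qed.

Lemma continuous_area_slack : continuous (fun z =>
  dx (f z) (h z) ^+ 2 - dy (f z) (h z) ^+ 2 - 4 * `|dz (f z) (h z)|).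
Proof.
move=> z; apply: cvgB.
  apply: cvgB; rewrite !expr2.
    by apply: cvgM; exact: continuous_dx.
  by apply: cvgM; exact: continuous_dy.
by apply: cvgM; [exact: cvg_cst|apply: cvg_norm; exact: continuous_dz].
Qed.

Lemma closed_cone_le : closed [set z | cone_le (f z) (h z)].
Proof.
have -> : [set z | cone_le (f z) (h z)] =
  (fun z => dx (f z) (h z) - `|dy (f z) (h z)|) @^-1` [set x | 0 <= x] `&`
  (fun z => dx (f z) (h z) ^+ 2 - dy (f z) (h z) ^+ 2 - 4 * `|dz (f z) (h z)|)
    @^-1` [set x | 0 <= x].
  by apply/seteqP; split=> z /=; rewrite /cone_le !subr_ge0.
apply: closedI; (apply: closed_comp; [move=> z _|exact: closed_ge]).
  exact: continuous_null_slack.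
exact: continuous_area_slack.
Qed.

Lemma open_cone_lt : open [set z | cone_lt (f z) (h z)].
Proof.
have -> : [set z | cone_lt (f z) (h z)] =
  (fun z => dx (f z) (h z) - `|dy (f z) (h z)|) @^-1` [set x | 0 < x] `&`
  (fun z => dx (f z) (h z) ^+ 2 - dy (f z) (h z) ^+ 2 - 4 * `|dz (f z) (h z)|)
    @^-1` [set x | 0 < x].
  by apply/seteqP; split=> z /=; rewrite /cone_lt !subr_gt0.
apply: openI; (apply: open_comp; [move=> z _|exact: open_gt]).
  exact: continuous_null_slack.
exact: continuous_area_slack.
Qed.

End continuity.

Lemma heis_causally_closed : causally_closed R.
Proof.
rewrite /causally_closed.
have -> : [set pq : heis R * heis R | causal_le pq.1 pq.2] =
    [set pq | cone_le pq.1 pq.2].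
  by apply/seteqP; split=> z /= /causal_leP.
by apply: closed_cone_le => z; [exact: cvg_fst|exact: cvg_snd].
Qed.

(** * Compactness of causal diamonds *)

Lemma diamond_bounded p q r M : `|p| <= M -> `|q| <= M ->
  cone_le p r -> cone_le r q ->
  [/\ `|r.1.1| <= M, `|r.1.2| <= 3 * M & `|r.2| <= M + 3 * M ^+ 2].
Proof.
move=> pM qM [h1 h2] [h3 _].
have M0 : 0 <= M by rewrite (le_trans _ pM).
have [px py pz] := coord_norm_le p; have [qx _ _] := coord_norm_le q.
have x1 := le_trans (normr_ge0 _) h1; have x2 := le_trans (normr_ge0 _) h3.
have px' := le_trans px pM; have py' := le_trans py pM.
have pz' := le_trans pz pM; have qx' := le_trans qx qM.
(* The coordinate x is monotone for the causal order, so that of r lies between those of p and q;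
   this bounds [dx p r], and the cone inequalities then bound [dy p r] and [dz p r]. *)
have rx : `|r.1.1| <= M.
  move: x1 x2 px' qx'; rewrite /dx !ler_norml => ? ? /andP[? ?] /andP[? ?].
  by apply/andP; split; lra.
have dx2 : dx p r <= 2 * M.
  by move: rx px'; rewrite /dx !ler_norml => /andP[? ?] /andP[? ?]; lra.
have ry : `|r.1.2| <= 3 * M.
  have := le_trans h1 dx2; move: py'; rewrite /dy !ler_norml => /andP[? ?] /andP[? ?].
  by apply/andP; split; lra.
split => //.
have zz : `|dz p r| <= M ^+ 2.
  have : dx p r ^+ 2 <= (2 * M) ^+ 2 by rewrite lerXn2r ?nnegrE// mulr_ge0.
  by rewrite exprMn; have := sqr_ge0 (dy p r); lra.
have e1 : `|p.1.1 * r.1.2| <= M * (3 * M) by rewrite normrM ler_pM.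
have e2 : `|r.1.1 * p.1.2| <= M * M by rewrite normrM ler_pM.
have -> : r.2 = dz p r + p.2 + (p.1.1 * r.1.2 - r.1.1 * p.1.2) / 2.
  by rewrite /dz; field.
apply: (le_trans (ler_normD _ _)).
rewrite [`|_ / 2|]normrM [X in _ * X]ger0_norm ?invr_ge0//.
have := ler_normD (dz p r) p.2.
by have := ler_normB (p.1.1 * r.1.2) (r.1.1 * p.1.2); rewrite expr2 in zz *; lra.
Qed.

(** The set is the projection of a compact set of triples (p, q, r) with p <= r <= q, the box B
    being there to confine r. *)
Lemma compact_causal_diamond (K1 K2 : set (heis R)) : compact K1 -> compact K2 ->
  compact (Jplus K1 `&` Jminus K2).
Proof.
move=> cK1 cK2.
have [M [K1M K2M]] : exists M, (forall p, K1 p -> `|p| <= M) /\ (forall p, K2 p -> `|p| <= M).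
  have [M1 [_ H1]] := compact_bounded cK1; have [M2 [_ H2]] := compact_bounded cK2.
  exists (Num.max M1 M2 + 1); split => p Kp.
    by apply: H1 Kp; rewrite ltr_pwDr// le_max lexx.
  by apply: H2 Kp; rewrite ltr_pwDr// le_max lexx orbT.
pose B : set (heis R) := (`[- M, M] `*` `[- (3 * M), 3 * M]) `*`
  `[- (M + 3 * M ^+ 2), M + 3 * M ^+ 2].
have cB : compact B.
  by do 2?apply: compact_setX; exact: segment_compact.
pose S : set (heis R * heis R * heis R) := ((K1 `*` K2) `*` B) `&`
  ([set z | cone_le z.1.1 z.2] `&` [set z | cone_le z.2 z.1.2]).
have cS : compact S.
  apply: compact_closedI; first by apply: compact_setX => //; exact: compact_setX.
  have f1 : continuous (fun z : heis R * heis R * heis R => z.1.1).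
    by move=> z; apply: (cvg_comp _ _ cvg_fst cvg_fst).
  have f2 : continuous (fun z : heis R * heis R * heis R => z.1.2).
    by move=> z; apply: (cvg_comp _ _ cvg_fst cvg_snd).
  have f3 : continuous (fun z : heis R * heis R * heis R => z.2).
    by move=> z; exact: cvg_snd.
  by apply: closedI; exact: closed_cone_le.
have -> : Jplus K1 `&` Jminus K2 = snd @` S.
  apply/seteqP; split=> [r [[p K1p /causal_leP pr] [q K2q /causal_leP rq]]|].
    exists ((p, q), r) => //; split => //; split=> //=.
    have [h1 h2 h3] := diamond_bounded (K1M _ K1p) (K2M _ K2q) pr rq.
    by split=> /=; [split=> /=|]; rewrite in_itv/= -ler_norml.
  move=> _ [[[p q] r] [[[/= K1p K2q] _] [/= pr rq]] <-] /=.
  by split; [exists p => //; apply/causal_leP|exists q => //; apply/causal_leP].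
apply: continuous_compact cS; apply: continuous_subspaceT => z; exact: cvg_snd.
Qed.

(** * Comparison of the Alexandrov, product and metric topologies *)

Lemma nbhs_sr_ball p (U : set (heis R)) : nbhs p U ->
  exists2 r : R, 0 < r & [set q | (sr_dist p q < r%:E)%E] `<=` U.
Proof.
move=> /nbhs_ballP[e /= e0 pU].
have P2 : 0 < 2 + `|p| by rewrite ltr_pwDl.
(* The z-coordinate moves by at most r^2 + r |p|, which r <= 1 turns into r (1 + |p|); the 2 in the
   denominator makes all the inequalities strict. *)
pose r := Num.min 1 (e / (2 + `|p|)).
have r0 : 0 < r by rewrite lt_min ltr01 divr_gt0.
have r1 : r <= 1 by rewrite ge_min lexx.
have re : r * (2 + `|p|) <= e by rewrite -ler_pdivlMr// ge_min lexx orbT.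
exists r => // q /ereal_inf_lt[_ [T [g [u [hor g0 gT ->]]]] Lr].
have := horizontal_displacement hor Lr; rewrite g0 gT => -[hx hy hz].
have re' : r < e by have := mulr_ge0 (ltW r0) (normr_ge0 p); lra.
apply: pU; split; first split.
- by rewrite /ball/= distrC (le_lt_trans hx).
- by rewrite /ball/= distrC (le_lt_trans hy).
rewrite /ball/= distrC.
have -> : q.2 - p.2 = dz p q + (p.1.1 * dy p q - dx p q * p.1.2) / 2.
  by rewrite /dx /dy /dz; field.
have [px py _] := coord_norm_le p.
apply: (le_lt_trans (ler_normD _ _)).
rewrite [`|_ / 2|]normrM [X in _ * X]ger0_norm ?invr_ge0//.
have := ler_normB (p.1.1 * dy p q) (dx p q * p.1.2); rewrite !normrM.
have := ler_pM (normr_ge0 _) (normr_ge0 _) px hy.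
have := ler_pM (normr_ge0 _) (normr_ge0 _) hx py.
have : r ^+ 2 <= r by rewrite expr2 ler_piMr// ltW.
by lra.
Qed.

Lemma diamondE p q : Iplus [set p] `&` Iminus [set q] =
  [set r | cone_lt p r] `&` [set r | cone_lt r q].
Proof.
apply/seteqP; split=> r.
  by move=> [[_ -> /chron_ltP pr] [_ -> /chron_ltP rq]].
by move=> [/chron_ltP pr /chron_ltP rq]; split; [exists p|exists q].
Qed.

Lemma open_diamond p q : open (Iplus [set p] `&` Iminus [set q] : set (heis R)).
Proof.
rewrite diamondE; apply: openI; apply: open_cone_lt => z //; exact: cvg_cst.
Qed.

(** A point q of the diamond need not be causally related to p, so the path goes through [q0]: at
    most e from p to [q0], then 4 e from [q0] to q, because x increases by at most 2 e. *)
Lemma small_diamond p (e : R) : 0 < e ->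
  let q0 := hstep p (- e, 0) in let q1 := hstep p (e, 0) in
  (Iplus [set q0] `&` Iminus [set q1]) p /\
  forall q, (Iplus [set q0] `&` Iminus [set q1]) q -> (sr_dist p q <= (5 * e)%:E)%E.
Proof.
move=> e0 q0 q1; rewrite diamondE.
have dxe : dx q0 p = e /\ dx p q1 = e.
  by rewrite /q0 /q1 /dx /hstep /heis_mul /=; split; ring.
have dy0 : dy q0 p = 0 /\ dy p q1 = 0.
  by rewrite /q0 /q1 /dy /hstep /heis_mul /=; split; ring.
have dz0 : dz q0 p = 0 /\ dz p q1 = 0.
  by rewrite /q0 /q1 /dz /hstep /heis_mul /=; split; field.
split.
  split; rewrite /= /cone_lt.
    by rewrite dxe.1 dy0.1 dz0.1 normr0 mulr0 expr0n/= subr0 exprn_gt0.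
  by rewrite dxe.2 dy0.2 dz0.2 normr0 mulr0 expr0n/= subr0 exprn_gt0.
move=> q [/cone_ltW h0 /cone_ltW h1].
apply: (le_trans (sr_dist_two_steps p h0)).
apply: (le_trans (leeD (sr_dist_hstep _ _) (lexx _))).
rewrite -EFinD lee_fin.
have := norm2_le (- e, 0); rewrite /= normr0 normrN (gtr0_norm e0).
have := le_trans (normr_ge0 _) h1.1; have [] := dxe; rewrite /dx; lra.
Qed.

(** The product topology links the other two: a finite intersection of diamonds is open in it and
    therefore contains a [sr_dist] ball around each of its points, while every such ball contains a
    diamond around its centre. *)
Lemma heis_strongly_causal : strongly_causal R.
Proof.
move=> A; split=> [[D' D'sub <-] p [i D'i ip]|oA].
  have [D0 _ iE] := D'sub _ D'i.
  have pi : nbhs p (i : set (heis R)).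
    rewrite -iE; apply: filter_bigI => j jD0.
    apply: open_nbhs_nbhs; split; first exact: open_diamond.
    by move: ip; rewrite -iE; apply.
  have [r r0 ri] := nbhs_sr_ball pi.
  by exists r => // q /ri iq; exists i.
rewrite openE => p Ap; have [r r0 rA] := oA p Ap.
(* With e = r / 6 the diamond has distance at most 5 r / 6 < r from p. *)
have e0 : 0 < r / 6 by rewrite divr_gt0.
have [pB BA] := small_diamond p e0.
rewrite /interior nbhsE.
exists (Iplus [set hstep p (- (r / 6), 0)] `&` Iminus [set hstep p (r / 6, 0)]).
  split; last exact: pB.
  exists [set Iplus [set hstep p (- (r / 6), 0)] `&` Iminus [set hstep p (r / 6, 0)]].
    move=> _ ->.
    exact: (@finI_from1 _ _ setT
      (fun pq : heis R * heis R => Iplus [set pq.1] `&` Iminus [set pq.2])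
      (hstep p (- (r / 6), 0), hstep p (r / 6, 0))).
  by rewrite bigcup_set1.
move=> q /BA h; apply: rA; apply: (le_lt_trans h); rewrite lte_fin; lra.
Qed.

End causality.

Theorem proposition18 (R : realType) :
  strongly_causal R /\
  causally_closed R /\
  sr_compatible R /\
  non_totally_imprisoning R /\
  globally_hyperbolic R /\
  K_globally_hyperbolic R.
Proof.
have nti := @heis_non_totally_imprisoning R.
split; first exact: heis_strongly_causal.
split; first exact: heis_causally_closed.
split; first exact: heis_sr_compatible.
split=> //; split; split => //; last exact: compact_causal_diamond.
by move=> p q; apply: compact_causal_diamond; exact: compact_set1.
Qed.
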